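(* Let $q \in \mathbb{N}$ be even and let $\mathcal{D}$ be a distribution over $\mathbb{R}^d$ with mean zero and covariance $\Sigma$ (with finite $q$-th moments). Then there is an absolute constant $C$ (independent of $q$, $d$, $\mathcal D$) such that: (1) If $\mathcal{D}$ is $(B_q, q)$-bounded, then $\mathcal{D}$ is $(d^{1/4 - 1/(2q)} B_q, q)$-certifiably bounded at degree $Cq$. (2) If $\mathcal{D}$ is $(B_q, q)$-hypercontractive, then $\mathcal{D}$ is $(d^{1/4 - 1/(2q)} B_q, q)$-certifiably hypercontractive at degree $Cq$.
   Context: Let $\mathcal D$ be a distribution over $\mathbb R^d$ with mean zero and covariance $\Sigma$, and $B_q>0$. $\mathcal D$ is $(B_q,q)$-bounded if $\mathbb{E}_{x\sim\mathcal D}\langle x,v\rangle^q \le B_q^q\|v\|_2^q$ for all $v\in\mathbb R^d$; it is $(B_q,q)$-hypercontractive if $\mathbb{E}_{x\sim\mathcal D}\langle x,v\rangle^q \le B_q^q\langle v,\Sigma v\rangle^{q/2}$ for all $v\in\mathbb R^d$. A polynomial $p$ in formal variables $v=(v_1,\dots,v_d)$ is a sum of squares of degree $\ell$ if $p(v)=\sum_r q_r(v)^2$ for polynomials $q_r$ with each $q_r^2$ of degree at most $\ell$. $\mathcal D$ is $(B_q,q)$-certifiably bounded at degree $\ell$ if $B_q^q\|v\|_2^q - \mathbb E_{x\sim\mathcal D}\langle x,v\rangle^q$ is a sum of squares of degree $\ell$ in $v$, and $(B_q,q)$-certifiably hypercontractive at degree $\ell$ if $B_q^q\langle v,\Sigma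 v\rangle^{q/2} - \mathbb E_{x\sim\mathcal D}\langle x,v\rangle^q$ is a sum of squares of degree $\ell$ in $v$. *)

(* Defs.v *)
From HB Require Import structures.
From mathcomp Require Import all_boot all_order all_algebra.
(* [mpoly] has to come before MathComp-Analysis: in the other order their     *)
(* notations clash.                                                           *)
From mathcomp Require Import mpoly.
From mathcomp Require Import all_classical all_reals all_analysis.

Set Implicit Arguments.
Unset Strict Implicit.
Unset Printing Implicit Defensive.

Import Order.TTheory GRing.Theory Num.Theory.
Import numFieldNormedType.Exports.

Local Open Scope classical_set_scope.
Local Open Scope ring_scope.

(* R^d is [d.-tuple R], whose library sigma-algebra (generated by the        *)
(* coordinate projections) is the Borel one; a distribution is a probability   *)
(* measure on it.                                                              *)

Section Euclidean.
Variables (R : realType) (d : nat).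
Implicit Types x v : d.-tuple R.

Definition dotp x v : R := \sum_(i < d) tnth x i * tnth v i.

Definition norm2 v : R := Num.sqrt (dotp v v).

Definition quadf (Sigma : 'M[R]_d) v : R :=
  \sum_(i < d) \sum_(j < d) tnth v i * Sigma i j * tnth v j.

End Euclidean.

Section Distributions.
Variables (R : realType) (d : nat) (D : probability (d.-tuple R) R).

Definition xcoord (i : 'I_d) : d.-tuple R -> R := fun x => tnth x i.

Definition finite_moment (q : nat) : Prop :=
  ('E_D[fun x => (norm2 x ^+ q)%R] < +oo)%E.

Definition mean_zero : Prop :=
  forall i, D.-integrable setT (EFin \o xcoord i) /\ ('E_D[xcoord i] = 0)%E.

Definition has_covariance (Sigma : 'M[R]_d) : Prop :=
  forall i j, covariance D (xcoord i) (xcoord j) = (Sigma i j)%:E.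

Definition bounded_moment (B : R) (q : nat) : Prop :=
  forall v : d.-tuple R,
    ('E_D[fun x => (dotp x v ^+ q)%R] <= (B ^+ q * norm2 v ^+ q)%:E)%E.

(* [q./2] is q/2 when q is even, the only case used. *)
Definition hypercontractive (Sigma : 'M[R]_d) (B : R) (q : nat) : Prop :=
  forall v : d.-tuple R,
    ('E_D[fun x => (dotp x v ^+ q)%R] <= (B ^+ q * quadf Sigma v ^+ q./2)%:E)%E.

End Distributions.

Section SumsOfSquares.
Variables (R : realType) (d : nat).

Definition var (i : 'I_d) : {mpoly R[d]} := 'X_i.

(* [msize] is the total degree plus one, and 0 for the zero polynomial. *)
Definition is_sos (l : nat) (p : {mpoly R[d]}) : Prop :=
  exists2 s : seq {mpoly R[d]},
    {in s, forall r : {mpoly R[d]}, (msize (r ^+ 2) <= l.+1)%N}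
    & p = \sum_(r <- s) r ^+ 2.

Definition normsq_poly : {mpoly R[d]} := \sum_(i < d) var i ^+ 2.

Definition quadf_poly (Sigma : 'M[R]_d) : {mpoly R[d]} :=
  \sum_(i < d) \sum_(j < d) Sigma i j *: (var i * var j).

Definition dotp_poly (x : d.-tuple R) : {mpoly R[d]} :=
  \sum_(i < d) tnth x i *: var i.

(* The polynomial E_(x ~ D) <x, v>^q in the formal variables v: the            *)
(* expectation is taken coefficientwise. The sum ranges over all multi-indices *)
(* of degree at most q, which contain the support of each <x, v>^q; [fine]     *)
(* acts on finite values as soon as D has finite q-th moments.                 *)
Definition moment_poly (D : probability (d.-tuple R) R) (q : nat) : {mpoly R[d]} :=
  \sum_(m : 'X_{1..d < q.+1})
     fine ('E_D[fun x => ((dotp_poly x ^+ q)@_m)%R])%E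
       *: 'X_[m].

(* For even q, ||v||_2^q is the polynomial (v_1^2 + ... + v_d^2)^(q/2). *)
Definition certifiably_bounded (D : probability (d.-tuple R) R)
    (B : R) (q l : nat) : Prop :=
  is_sos l (B ^+ q *: normsq_poly ^+ q./2 - moment_poly D q).

Definition certifiably_hypercontractive (D : probability (d.-tuple R) R)
    (Sigma : 'M[R]_d) (B : R) (q l : nat) : Prop :=
  is_sos l (B ^+ q *: quadf_poly Sigma ^+ q./2 - moment_poly D q).

End SumsOfSquares.

(* Main.v *)
Require Import Defs.
From HB Require Import structures.
From mathcomp Require Import all_boot all_order all_algebra.
From mathcomp Require Import ring lra zify.
From mathcomp Require Import complex.
From mathcomp Require Import mpoly.
From mathcomp Require Import all_classical all_reals all_analysis.
From mathcomp Require Import measurable_realfun.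

Set Implicit Arguments.
Unset Strict Implicit.
Unset Printing Implicit Defensive.

Import Order.TTheory GRing.Theory Num.Theory.
Import numFieldNormedType.Exports.

Local Open Scope ring_scope.

(** Write [q = 2 (s + 1)]; the certificate even has degree [q], that is [C = 1].

    The cone of sums of squares of degree at most [q] is closed, so it suffices
    to bound [l(E <x, v>^q)] by [c N], where [l] is any linear functional that
    is nonnegative on squares, [N = l(|v|^q)] and
    [c = d^(q/4 - 1/2) B^q = d^(s/2) B^q].
    In an orthonormal basis diagonalising the matrix [l(v_i v_j |v|^(2s))], with
    eigenvalues [k_i] of sum [N], expand
    [l(E <x, v>^q) = sum T S] over [i], [j] and words [a], [b] of length [s],
    where [T = E(x_i x_j x_a x_b)] and [S = l(v_i v_j v_a v_b)], and apply the
    Cauchy-Schwarz inequality with weights [(eta_i eta_j)^(1/2)], where [eta] is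
    [k] normalised to sum 1 (perturbed in order to be positive):
    - [sum T^2 (eta_i eta_j)^(1/2)] is the expectation over independent copies
      [x], [x'] of [(sum_i eta_i^(1/2) x_i x'_i)^2 <x, x'>^(2s)]; Young's and
      Jensen's inequalities bound it by [B^(2q) d^s];
    - by positivity and symmetry of [S],
      [sum S^2 (eta_i eta_j)^(-1/2)] is at most [sum_i k_i^2 / eta_i = N^2].

    The hypercontractive case reduces to the bounded one by the linear change of
    variables given by a factorization [Sigma + e I = W^T W], letting [e] tend
    to 0 inside [l]. *)

(** * Factorization and diagonalization of real symmetric matrices *)

Section LinearAlgebra.
Variable R : rcfType.

Let mxD m n (A B : 'M[R]_(m, n)) i j : (A + B) i j = A i j + B i j.
Proof. by rewrite mxE. Qed.
Let mxN m n (A : 'M[R]_(m, n)) i j : (- A) i j = - A i j.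
Proof. by rewrite mxE. Qed.
Let mxZ m n c (A : 'M[R]_(m, n)) i j : (c *: A) i j = c * A i j.
Proof. by rewrite mxE. Qed.

Lemma linear_lower_bound_eq0 (a b : R) : (forall t, 0 <= t * a + b) -> a = 0.
Proof.
move=> h; apply/eqP/negPn/negP => a0.
have := h ((- b - 1) / a); rewrite mulfVK //; lra.
Qed.

Definition psdmx n (S : 'M[R]_n) :=
  forall u : 'rV[R]_n, 0 <= (u *m S *m u^T) 0 0.

(** Cholesky factorization by induction on the size: split off the first row and column, then factor
    the Schur complement of the corner entry. *)
Lemma psdmx_factor n (S : 'M[R]_n) :
  S^T = S -> psdmx S -> exists W : 'M[R]_n, S = W^T *m W.
Proof.
elim: n S => [|n IHn] S; first by move=> _ _; exists 0; apply/matrixP => -[].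
rewrite -[n.+1]/(1 + n)%N in S *.
rewrite -[S]submxK; set a := ulsubmx S; set b := ursubmx S; set b' := dlsubmx S.
set C := drsubmx S.
rewrite tr_block_mx => /eq_block_mx[_ _ eb' eC] Spsd.
have {eb'}eb' : b' = b^T by rewrite -eb'.
rewrite {b'}eb' in Spsd *.
have Sval (t : R) (w : 'rV_n) : ((row_mx t%:M w) *m block_mx a b b^T C *m (row_mx t%:M w)^T) 0 0
    = t ^+ 2 * a 0 0 + 2 * (t * (b *m w^T) 0 0) + (w *m C *m w^T) 0 0.
  rewrite tr_row_mx mul_row_block mul_row_col tr_scalar_mx !mul_scalar_mx mul_mx_scalar.
  rewrite mulmxDl -scalemxAl !(mxD, mxZ).
  have -> : (w *m b^T) 0 0 = (b *m w^T) 0 0.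
    by rewrite -[w *m _]trmxK trmx_mul trmxK mxE.
  ring.
have Sge (t : R) (w : 'rV_n) : 0 <= t ^+ 2 * a 0 0 + 2 * (t * (b *m w^T) 0 0) + (w *m C *m w^T) 0 0.
  by have := Spsd (row_mx t%:M w); rewrite Sval.
have a0 : 0 <= a 0 0.
  have := Sge 1 0; rewrite trmx0 !mulmx0 ?mul0mx ![(0 : 'M[R]_1) _ _]mxE; lra.
(* With a zero corner the quadratic form is affine in the first coordinate [t], so nonnegativity
   forces the rest [b] of the first row to vanish. *)
have [az|anz] := eqVneq (a 0 0) 0.
  have b0 : b = 0.
    apply/rowP => j; rewrite [RHS]mxE.
    have : (b *m (delta_mx 0 j : 'rV_n)^T) 0 0 = 0.
      apply: (@linear_lower_bound_eq0 _ (((delta_mx 0 j : 'rV_n) *m C *m (delta_mx 0 j : 'rV_n)^T) 0 0)) => t.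
      have := Sge (t / 2) (delta_mx 0 j).
      rewrite az mulr0 add0r.
      by rewrite mulrA [2 * _]mulrC mulfVK // pnatr_eq0.
    by rewrite trmx_delta -colE mxE.
  have [W' eW'] : exists W : 'M[R]_n, C = W^T *m W.
    apply: IHn => [//|w]; have := Sge 0 w.
    by rewrite expr0n /= !mul0r mulr0 !add0r.
  exists (block_mx 0 0 0 W').
  rewrite tr_block_mx mulmx_block !trmx0 !mulmx0 !mul0mx !addr0 !add0r -eW' b0 trmx0.
  by congr block_mx; apply/rowP => i; rewrite !ord1 az mxE.
have apos : 0 < a 0 0 by rewrite lt_def anz.
pose s := Num.sqrt (a 0 0).
have sgt : 0 < s by rewrite sqrtr_gt0.
have s2 : s * s = a 0 0 by rewrite -expr2 sqr_sqrtr.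
have [W' eW'] : exists W : 'M[R]_n, C - (a 0 0)^-1 *: (b^T *m b) = W^T *m W.
  apply: IHn => [|w].
    by rewrite linearB /= eC linearZ /= trmx_mul trmxK.
  set z := (b *m w^T) 0 0.
  (* This [t] minimises the form over the first coordinate; the minimum is the form of the Schur
     complement at [w]. *)
  have := Sge (- z / a 0 0) w; rewrite -/z.
  rewrite mulmxBr mulmxBl -scalemxAr -scalemxAl mulmxA -[w *m _ *m _ *m _]mulmxA.
  rewrite mxD mxN mxZ [((w *m b^T) *m _) 0 0]mxE big_ord1.
  have -> : (w *m b^T) 0 0 = z.
    by rewrite -[w *m _]trmxK trmx_mul trmxK mxE.
  rewrite -/z; suff -> : (- z / a 0 0) ^+ 2 * a 0 0 + 2 * (- z / a 0 0 * z) = - ((a 0 0)^-1 * (z * z)).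
    by rewrite addrC.
  by field.
exists (block_mx s%:M (s^-1 *: b) 0 W').
rewrite tr_block_mx mulmx_block !trmx0 !mulmx0 !mul0mx !addr0 tr_scalar_mx.
have -> : (s^-1 *: b)^T = s^-1 *: b^T by rewrite linearZ.
rewrite !mul_scalar_mx mul_mx_scalar -scalemxAl -scalemxAr !scalerA.
rewrite mulfV ?gt_eqF // !scale1r -invfM s2 -eW' addrC subrK.
by congr block_mx; apply/matrixP => i j; rewrite !ord1 mxZ [_%:M _ _]mxE eqxx mulr1n s2.
Qed.

Lemma psd_kernel_factor (J : finType) (S : J -> J -> R) :
  (forall j k, S j k = S k j) ->
  (forall c : J -> R, 0 <= \sum_j \sum_k c j * c k * S j k) ->
  exists W : 'I_#|J| -> J -> R, forall j k, S j k = \sum_l W l j * W l k.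
Proof.
move=> Ssym Spsd; pose ev (i : 'I_#|J|) : J := enum_val i.
have evb : {on predT, bijective ev} by apply/onW_bij/enum_val_bij.
have [|u|W eW] := @psdmx_factor _ (\matrix_(i < #|J|, j < #|J|) S (ev i) (ev j)).
- by apply/matrixP => i j; rewrite !mxE Ssym.
- have := Spsd (fun j => u 0 (enum_rank j)); rewrite (reindex ev) //=.
  congr (_ <= _); rewrite mxE.
  under eq_bigr do rewrite (reindex ev) //=.
  rewrite exchange_big; apply: eq_bigr => j _; rewrite !mxE mulr_suml.
  by apply: eq_bigr => i _; rewrite !mxE !enum_valK mulrAC.
- exists (fun l j => W l (enum_rank j)) => j k.
  move/matrixP: eW => /(_ (enum_rank j) (enum_rank k)).
  by rewrite !mxE /ev !enum_rankK => ->; apply: eq_bigr => i _; rewrite mxE.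
Qed.

(** Over the complex numbers [Q] is Hermitian, so its spectral diagonal is real; the first diagonal
    entry is a root of the characteristic polynomial, which has real coefficients. *)
Lemma symmetric_eigenvalue n (Q : 'M[R]_n.+1) :
  Q^T = Q -> exists a : R, eigenvalue Q a.
Proof.
move=> Qs; pose f := real_complex R; pose Qc := map_mx f Q.
have Qh : Qc \is hermsymmx.
  apply: realsym_hermsym.
    apply/is_hermitianmxP; rewrite expr0 scale1r map_mx_id //.
    by rewrite /Qc -{1}Qs map_trmx.
  by apply/mxOverP => i j; rewrite mxE complex_real.
have /mxOverP/(_ 0 0)/complex_realP[a ea] := hermitian_spectral_diag_real Qh.
exists a; rewrite eigenvalue_root_char.
rewrite -(fmorph_root f) -/f map_char_poly -eigenvalue_root_char -/Qc.
have /hermitian_normalmx/orthomx_spectralP eQ := Qh.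
apply/eigenvalueP; exists (row 0 (spectralmx Qc)).
  rewrite -row_mul {2}eQ !mulmxA mulmxV ?spectral_unit // mul1mx row_mul row_diag_mx.
  by rewrite -scalemxAl -rowE ea.
apply/negP => /eqP r0; have := spectral_unit Qc.
move/mulmxV/(congr1 (row 0)); rewrite row_mul r0 mul0mx row1 => /rowP/(_ 0).
by rewrite !mxE /= => /esym/eqP; rewrite oner_eq0.
Qed.

Lemma symmetric_unit_eigenvector n (Q : 'M[R]_n.+1) : Q^T = Q ->
  exists a (u : 'rV_n.+1), u *m Q = a *: u /\ u *m u^T = 1%:M.
Proof.
move=> /symmetric_eigenvalue[a /eigenvalueP[u uQ u0]].
pose s := (u *m u^T) 0 0.
have sE : s = \sum_i u 0 i ^+ 2.
  by rewrite /s mxE; apply: eq_bigr => i _; rewrite mxE expr2.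
have sgt : 0 < s.
  rewrite lt_def sE sumr_ge0 ?andbT => [|i _]; last exact: sqr_ge0.
  apply: contra_neq u0 => /psumr_eq0P su; apply/rowP => i; rewrite mxE.
  by apply/eqP; rewrite -sqrf_eq0 su // => j _; exact: sqr_ge0.
exists a, ((Num.sqrt s)^-1 *: u); split.
  by rewrite -scalemxAl uQ !scalerA mulrC.
rewrite linearZ /= -scalemxAl -scalemxAr scalerA -invfM -expr2 sqr_sqrtr ?ltW //.
by rewrite [u *m _]mx11_scalar -/s scale_scalar_mx mulVf ?gt_eqF.
Qed.

(* The Householder reflection exchanging [u] and the first basis vector. *)
Lemma orthogonal_with_first_row n (u : 'rV[R]_n.+1) : u *m u^T = 1%:M ->
  exists H : 'M[R]_n.+1, [/\ H^T = H, H *m H = 1%:M & row 0 H = u].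
Proof.
move=> uu; pose e : 'rV[R]_n.+1 := delta_mx 0 0.
pose w := e - u; pose s := (w *m w^T) 0 0.
have sE : s = \sum_i w 0 i ^+ 2.
  by rewrite /s mxE; apply: eq_bigr => i _; rewrite [w^T _ _]mxE expr2.
have ue : (u *m e^T) 0 0 = u 0 0 by rewrite trmx_delta -colE mxE.
have eu : (e *m u^T) 0 0 = u 0 0 by rewrite -rowE !mxE.
have ee : (e *m e^T) 0 0 = 1 by rewrite trmx_delta -colE !mxE.
have ew : (e *m w^T) 0 0 = 1 - u 0 0.
  by rewrite linearB /= mulmxBr mxD mxN ee eu.
have s2 : s = 2 * (1 - u 0 0).
  rewrite /s /w linearB /= mulmxBr !mulmxBl.
  rewrite !(mxD, mxN).
  rewrite ee ue eu uu mxE eqxx /=; ring.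
(* If s = |e - u|^2 vanishes then [u] is already [e]; otherwise reflect in the hyperplane orthogonal
   to [w]. *)
have [s0|sn0] := eqVneq s 0.
  exists 1%:M; split; rewrite ?trmx1 ?mulmx1 // row1.
  apply/eqP; rewrite -subr_eq0 -/e -/w; apply/eqP/rowP => i; rewrite [RHS]mxE.
  apply/eqP; rewrite -sqrf_eq0.
  by move: s0; rewrite sE => /psumr_eq0P -> // j _; exact: sqr_ge0.
exists (1%:M - (2 / s) *: (w^T *m w)); split.
- by rewrite linearB /= trmx1 linearZ /= trmx_mul trmxK.
- have : (w^T *m w) *m (w^T *m w) = s *: (w^T *m w).
    by rewrite mulmxA -[w^T *m w *m w^T]mulmxA [w *m w^T]mx11_scalar mul_mx_scalar -scalemxAl.
  move: (w^T *m w) => P PP.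
  rewrite mulmxBl mul1mx mulmxBr mulmx1 -scalemxAl -scalemxAr PP !scalerA.
  by apply/matrixP => i j; rewrite !mxE; field.
- rewrite rowE -/e mulmxBr mulmx1 -scalemxAr mulmxA [e *m w^T]mx11_scalar ew.
  rewrite mul_scalar_mx scalerA s2 invfM mulrA mulfV ?pnatr_eq0 // mul1r mulVf.
    by rewrite scale1r /w opprB addrCA subrr addr0.
  by apply: contra_neq sn0; rewrite s2 => ->; rewrite mulr0.
Qed.

(** Deflation: a reflection [H] moves a unit eigenvector to the first basis vector, after which
    [H *m Q *m H] is block diagonal and the induction hypothesis treats the lower block. *)
Theorem symmetric_diagonalization n (Q : 'M[R]_n) : Q^T = Q ->
  exists (U : 'M[R]_n) (k : 'rV[R]_n),
    U *m U^T = 1%:M /\ U *m Q *m U^T = diag_mx k.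
Proof.
elim: n Q => [|n IHn] Q Qs.
  by exists 1%:M, 0; split; apply/matrixP => -[].
have [a [u [uQ uu]]] := symmetric_unit_eigenvector Qs.
have [H [Hs HH Hu]] := orthogonal_with_first_row uu.
pose P : 'M[R]_(1 + n) := H *m Q *m H.
have P0 : row 0 P = a *: delta_mx 0 0.
  by rewrite !row_mul Hu uQ -scalemxAl -Hu -row_mul HH row1.
have Ps : P^T = P by rewrite !trmx_mul Hs Qs mulmxA.
have P0E j : P 0 j = a * (j == 0)%:R.
  by have /rowP/(_ j) := P0; rewrite [LHS]mxE mxZ [delta_mx _ _ _ _]mxE eqxx.
have ePl : ulsubmx P = a%:M.
  apply/matrixP => i j; rewrite !ord1 [RHS]mxE [LHS]mxE [LHS]mxE.
  have -> : lshift n 0 = 0 :> 'I_(1 + n) by apply/val_inj.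
  by rewrite P0E eqxx mulr1.
have ePr : ursubmx P = 0.
  apply/matrixP => i j; rewrite !ord1 [RHS]mxE [LHS]mxE [LHS]mxE.
  have -> : lshift n 0 = 0 :> 'I_(1 + n) by apply/val_inj.
  by rewrite P0E mulr0.
have ePd : dlsubmx P = 0 by rewrite -Ps -trmx_ursub ePr trmx0.
have [|U [k [UU Uk]]] := IHn (drsubmx P).
  by rewrite trmx_drsub Ps.
pose V : 'M[R]_(1 + n) := block_mx 1%:M 0 0 U.
have VV : V *m V^T = 1%:M.
  rewrite tr_block_mx mulmx_block !trmx0 !mulmx0 !mul0mx !addr0 !add0r trmx1 mulmx1 UU.
  by rewrite -scalar_mx_block.
have VPV : V *m P *m V^T = diag_mx (row_mx a%:M k).
  rewrite -[P]submxK ePl ePr ePd tr_block_mx !mulmx_block !trmx0 !mulmx0 !mul0mx !addr0 !add0r.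
  rewrite ?mul0mx !mul1mx ?mulmx0 ?addr0 ?add0r Uk trmx1 mulmx1 diag_mx_row.
  by congr block_mx; apply/matrixP => i j; rewrite !ord1 !mxE.
exists (V *m H), (row_mx a%:M k : 'rV_(1 + n)); rewrite trmx_mul Hs; split.
  by rewrite mulmxA -[V *m H *m H]mulmxA HH mulmx1.
by rewrite -VPV /P !mulmxA.
Qed.
End LinearAlgebra.

(** * Young's, Jensen's and Cauchy-Schwarz inequalities *)

Section Inequalities.
Variable R : realFieldType.

(** Induction on [s]: multiply by [w] and add (u - w)(u^(s+1) - w^(s+1)) >= 0. *)
Lemma young_power (s : nat) (u w : R) : 0 <= u -> 0 <= w ->
  s.+1%:R * (u * w ^+ s) <= u ^+ s.+1 + s%:R * w ^+ s.+1.
Proof.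
move=> u0 w0; elim: s => [|s IH]; first by rewrite !mul1r mulr1 mul0r addr0.
have h : u * w ^+ s.+1 + u ^+ s.+1 * w <= u ^+ s.+2 + w ^+ s.+2.
  have : 0 <= (u - w) * (u ^+ s.+1 - w ^+ s.+1).
    have [uw|/ltW wu] := leP u w.
      by rewrite mulr_le0 // subr_le0 // lerXn2r.
    by rewrite mulr_ge0 // subr_ge0 // lerXn2r.
  by rewrite mulrBl !mulrBr -!exprS [w * _]mulrC; lra.
have := ler_wpM2r w0 IH.
rewrite mulrDl -mulrA -(mulrA u) -exprSr -mulrA -exprSr => IH'.
rewrite -(natr1 s.+1) -(natr1 s) mulrDl mul1r mulrDl mul1r.
by move: IH'; rewrite -(natr1 s); lra.
Qed.

(** Average over [eta] the tangent line inequality at the mean [m], which is [young_power] with [w]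
    = [m]. *)
Lemma jensen_power (I : finType) (eta u : I -> R) (s : nat) :
  (forall i, 0 <= eta i) -> \sum_i eta i = 1 -> (forall i, 0 <= u i) ->
  (\sum_i eta i * u i) ^+ s.+1 <= \sum_i eta i * u i ^+ s.+1.
Proof.
move=> eta0 eta1 u0; set m := \sum_i eta i * u i.
have m0 : 0 <= m by rewrite sumr_ge0 // => i _; rewrite mulr_ge0.
have : \sum_i eta i * (s.+1%:R * (u i * m ^+ s)) <=
       \sum_i eta i * (u i ^+ s.+1 + s%:R * m ^+ s.+1).
  by apply: ler_sum => i _; rewrite ler_wpM2l ?young_power.
under [X in X <= _]eq_bigr do rewrite mulrCA (mulrA (eta _)).
rewrite -mulr_sumr -mulr_suml -/m -exprS.
under [X in _ <= X]eq_bigr do rewrite mulrDr.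
rewrite big_split /= -mulr_suml eta1 mul1r -(natr1 s) mulrDl mul1r; lra.
Qed.

(** Lagrange's identity: twice the difference of the two sides is the sum of (S_i T_j w_j - S_j T_i
    w_i)^2 / (w_i w_j). *)
Lemma weighted_cauchy_schwarz (I : finType) (S T w : I -> R) :
  (forall i, 0 < w i) ->
  (\sum_i S i * T i) ^+ 2 <= (\sum_i S i ^+ 2 / w i) * (\sum_i T i ^+ 2 * w i).
Proof.
move=> w0; rewrite expr2 !mulr_suml.
rewrite -subr_ge0 -[X in 0 <= X](@mulfVK _ 2) ?pnatr_eq0 //.
rewrite mulr_ge0 // mulrC.
have -> : 2^-1 * (\sum_i S i ^+ 2 / w i * (\sum_j T j ^+ 2 * w j) - \sum_i S i * T i * (\sum_j S j * T j))
   = 4^-1 * \sum_i \sum_j (S i * T j * w j - S j * T i * w i) ^+ 2 / (w i * w j).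
  have e1 : \sum_i S i ^+ 2 / w i * (\sum_j T j ^+ 2 * w j) = \sum_i \sum_j S i ^+ 2 * T j ^+ 2 * (w j / w i).
    apply: eq_bigr => i _; rewrite mulr_sumr; apply: eq_bigr => j _; ring.
  have e2 : \sum_i S i ^+ 2 / w i * (\sum_j T j ^+ 2 * w j) = \sum_i \sum_j S j ^+ 2 * T i ^+ 2 * (w i / w j).
    by rewrite e1 exchange_big.
  have e3 : \sum_i S i * T i * (\sum_j S j * T j) = \sum_i \sum_j S i * T i * S j * T j.
    by apply: eq_bigr => i _; rewrite mulr_sumr; apply: eq_bigr => j _; ring.
  have e4 : \sum_i \sum_j (S i * T j * w j - S j * T i * w i) ^+ 2 / (w i * w j) =
    (\sum_i \sum_j S i ^+ 2 * T j ^+ 2 * (w j / w i)) + (\sum_i \sum_j S j ^+ 2 * T i ^+ 2 * (w i / w j))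
     - 2 * \sum_i \sum_j S i * T i * S j * T j.
    rewrite mulr_sumr -sumrN -!big_split /=; apply: eq_bigr => i _.
    rewrite mulr_sumr -sumrN -!big_split /=; apply: eq_bigr => j _.
    by field; rewrite !gt_eqF.
  rewrite e4 -e1 -e2 -e3; lra.
rewrite mulr_ge0 ?invr_ge0 // sumr_ge0 // => i _; rewrite sumr_ge0 // => j _.
by rewrite mulr_ge0 ?sqr_ge0 // invr_ge0 mulr_ge0 // ltW.
Qed.

End Inequalities.

(** * Powers of a finite sum as sums over words *)

Section PowerOfSum.
Variables (A : comPzRingType) (I : finType).
Implicit Types F : I -> A.

Lemma expr_sum_distr F n :
  (\sum_i F i) ^+ n = \sum_(a : {ffun 'I_n -> I}) \prod_k F (a k).
Proof.
rewrite -[n in LHS]card_ord -prodr_const.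
by rewrite bigA_distr_bigA.
Qed.
End PowerOfSum.

(** * Bounds on the total degree *)

Section Degree.
Variables (R : idomainType) (d : nat).
Implicit Types p q : {mpoly R[d]}.

Lemma mpoly_scaleM (a b : R) p q : (a *: p) * (b *: q) = (a * b) *: (p * q).
Proof. by rewrite -scalerAl -scalerAr scalerA. Qed.

Definition degle n p := (msize p <= n.+1)%N.

Lemma degleW m n p : (m <= n)%N -> degle m p -> degle n p.
Proof. by move=> mn hp; exact: leq_trans hp _. Qed.

Lemma degle0 n : degle n 0.
Proof. by rewrite /degle msize0. Qed.

Lemma degleC n c : degle n c%:MP.
Proof. by rewrite /degle msizeC; case: (c != 0). Qed.

Lemma degle1 n : degle n 1.
Proof. exact: degleC. Qed.

Lemma degleXU i : degle 1 'X_i.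
Proof. by rewrite /degle msizeX mdeg1. Qed.

Lemma degleZ n c p : degle n p -> degle n (c *: p).
Proof. exact/leq_trans/msizeZ_le. Qed.

Lemma degleN n p : degle n p -> degle n (- p).
Proof. by rewrite /degle msizeN. Qed.

Lemma degleD n p q : degle n p -> degle n q -> degle n (p + q).
Proof.
by move=> hp hq; apply: leq_trans (msizeD_le _ _) _; rewrite geq_max; apply/andP.
Qed.

Lemma degleB n p q : degle n p -> degle n q -> degle n (p - q).
Proof. by move=> hp /degleN; exact: degleD. Qed.

Lemma degle_sum (J : Type) (r : seq J) (P : pred J) (F : J -> {mpoly R[d]}) n :
  (forall j, P j -> degle n (F j)) -> degle n (\sum_(j <- r | P j) F j).
Proof. by move=> h; elim/big_ind: _ => //; [exact: degle0 | exact: degleD]. Qed.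

Lemma degleM m n p q : degle m p -> degle n q -> degle (m + n) (p * q).
Proof.
have [->|p0] := eqVneq p 0; first by move=> *; rewrite mul0r degle0.
have [->|q0] := eqVneq q 0; first by move=> *; rewrite mulr0 degle0.
rewrite /degle => hp hq; rewrite msizeM // -subn1 leq_subLR add1n.
by rewrite (leq_trans (leq_add hp hq)) // addSn addnS.
Qed.

Lemma degleX m n p : degle m p -> degle (m * n) (p ^+ n).
Proof.
move=> hp; elim: n => [|n IH]; first by rewrite expr0 muln0 degle1.
by rewrite exprS mulnS degleM.
Qed.

Lemma degle_prod (J : finType) (F : J -> {mpoly R[d]}) (m : J -> nat) :
  (forall j, degle (m j) (F j)) -> degle (\sum_j m j) (\prod_j F j).
Proof.
move=> h; elim/big_rec2: _ => [|j a b _ hab]; first exact: degle1.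
by rewrite degleM.
Qed.

Lemma degle_comp n p (lq : d.-tuple {mpoly R[d]}) :
  (forall i, degle 1 (tnth lq i)) -> degle n p -> degle n (p \mPo lq).
Proof.
move=> hlq hp; rewrite comp_mpolyEX big_seq; apply: degle_sum => m mp.
apply: degleZ; rewrite comp_mpolyX.
apply: (@degleW (\sum_(i < d) 1 * m i)).
  have := leq_trans (msize_mdeg_lt mp) hp; rewrite ltnS mdegE.
  by rewrite (eq_bigr (fun i => 1 * m i)%N) // => i _; rewrite mul1n.
by apply: degle_prod => i; exact: degleX.
Qed.
End Degree.

(** * Polynomials in two groups of variables, and pairs of functionals *)

Section Tensors.
Variables (R : rcfType) (d : nat).
Local Notation P := {mpoly R[d]}.
Implicit Types (p q : P) (L l : {scalar P}).

(* Polynomials in two groups of variables [(x, v)] are polynomials in [v] over *)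
(* the ring of polynomials in [x]; [tens p q] is [p(x) q(v)].                  *)
Definition tens p q : {mpoly P[d]} := p%:MP * map_mpoly (@mpolyC d R) q.

Lemma tensM p p' q q' : tens p q * tens p' q' = tens (p * p') (q * q').
Proof. by rewrite /tens mulrACA -mpolyCM -rmorphM. Qed.

Lemma tens_prod (I : finType) (F G : I -> P) :
  \prod_i tens (F i) (G i) = tens (\prod_i F i) (\prod_i G i).
Proof.
rewrite /tens big_split /= -rmorph_prod; congr (_ * _).
by rewrite rmorph_prod.
Qed.

Lemma expr_sum_tens (I : finType) (F G : I -> P) n :
  (\sum_i tens (F i) (G i)) ^+ n =
    \sum_(a : {ffun 'I_n -> I}) tens (\prod_k F (a k)) (\prod_k G (a k)).
Proof. by rewrite expr_sum_distr; apply: eq_bigr => a _; rewrite tens_prod. Qed.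

Lemma map_tens L p q : map_mpoly L (tens p q) = L p *: q.
Proof.
apply/mpolyP => m; rewrite mcoeff_map_mpoly mcoeffZ /tens mcoeffCM mcoeff_map_mpoly.
by rewrite [p * _]mulrC mul_mpolyC /= scalarZ mulrC.
Qed.

(** The form <x, v>. *)
Definition pairing : {mpoly P[d]} := \sum_(i < d) tens 'X_i 'X_i.

(** [L] acts on the variables [x] and [l] on the variables [v]. When [L] is the expectation over
    [x], the value at [pairing ^+ q] is [l] of E <x, v>^q. *)
Definition tensor_eval L l (p : {mpoly P[d]}) : R := l (map_mpoly L p).

Lemma tensor_eval_tens L l p q : tensor_eval L l (tens p q) = L p * l q.
Proof. by rewrite /tensor_eval map_tens scalarZ. Qed.

Lemma tensor_eval_sum L l (I : finType) (F : I -> {mpoly P[d]}) :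
  tensor_eval L l (\sum_i F i) = \sum_i tensor_eval L l (F i).
Proof.
rewrite /tensor_eval -[RHS](raddf_sum l); congr (l _).
exact: (raddf_sum (map_mpoly L)).
Qed.

Definition linform (c : 'I_d -> R) : P := \sum_i c i *: 'X_i.

Definition linforms (M : 'M[R]_d) : d.-tuple P := [tuple linform (M i) | i < d].

Lemma tnth_linforms M i : tnth (linforms M) i = linform (M i).
Proof. by rewrite tnth_mktuple. Qed.

Lemma linform_eval c x : (linform c).@[x] = \sum_i c i * x i.
Proof. by rewrite raddf_sum; apply: eq_bigr => i _; rewrite /= mevalZ mevalXU. Qed.

Lemma degle_linform c : degle 1 (linform c).
Proof. by apply: degle_sum => i _; apply/degleZ/degleXU. Qed.

Lemma comp_linform (c : 'I_d -> R) (M : 'M[R]_d) :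
  linform c \mPo linforms M = linform (fun j => \sum_i c i * M i j).
Proof.
rewrite raddf_sum /=.
under eq_bigr do rewrite comp_mpolyZ comp_mpolyXU -tnth_nth tnth_linforms scaler_sumr.
rewrite exchange_big; apply: eq_bigr => j _ /=; rewrite scaler_suml.
by apply: eq_bigr => i _; rewrite scalerA.
Qed.

(** Because <A x, C v> = <x, A^T C v> = <x, v>. It serves for an orthogonal [A] = [C], and for [C] =
    [W] with [A] the inverse transpose of [W]. *)
Lemma tensor_eval_comp L l (A C : 'M[R]_d) n : A^T *m C = 1%:M ->
  tensor_eval (L \o comp_mpoly (linforms A)) (l \o comp_mpoly (linforms C)) (pairing ^+ n)
  = tensor_eval L l (pairing ^+ n).
Proof.
move=> AC.
have pE : pairing = \sum_i tens (linform (A i)) (linform (C i)).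
  have tE i : tens (linform (A i)) (linform (C i)) = 
     \sum_j \sum_k ((A i j * C i k)%:MP)%:MP * tens 'X_j 'X_k.
    rewrite /tens /linform raddf_sum /= mulr_suml; apply: eq_bigr => j _.
    rewrite raddf_sum /= mulr_sumr; apply: eq_bigr => k _.
    rewrite map_mpolyZ -!mul_mpolyC !mpolyCM; ring.
  have mpCC (I : finType) (F : I -> R) :
      \sum_i ((F i)%:MP_[d])%:MP_[d] = ((\sum_i F i)%:MP)%:MP :> {mpoly P[d]}.
    by rewrite (raddf_sum (@mpolyC d R)) (raddf_sum (@mpolyC d P)).
  have ACE j k : \sum_i A i j * C i k = (j == k)%:R.
    move/matrixP: AC => /(_ j k); rewrite !mxE => <-.
    by apply: eq_bigr => i _; rewrite mxE.
  transitivity (\sum_j \sum_k ((j == k)%:R%:MP_[d])%:MP_[d] * tens 'X_j 'X_k).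
    apply: eq_bigr => j _; rewrite (bigD1 j) //= big1 => [|k].
      by rewrite eqxx addr0 mul1r.
    by rewrite eq_sym => /negPf ->; rewrite !mpolyC0 mul0r.
  rewrite (eq_bigr _ (fun i _ => tE i)) [RHS]exchange_big /=; apply: eq_bigr => j _.
  rewrite [RHS]exchange_big /=; apply: eq_bigr => k _.
  by rewrite -mulr_suml mpCC ACE.
have e2 : pairing ^+ n = \sum_(a : {ffun 'I_n -> 'I_d})
    tens (\prod_k linform (A (a k))) (\prod_k linform (C (a k))).
  by rewrite pE; exact: expr_sum_tens.
have e1 : pairing ^+ n = \sum_(a : {ffun 'I_n -> 'I_d})
    tens (\prod_k 'X_(a k)) (\prod_k 'X_(a k)).
  exact: expr_sum_tens.
move: (pairing ^+ n) e1 e2 => p e1 e2.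
rewrite {1}e1 e2.
rewrite [LHS]tensor_eval_sum [RHS]tensor_eval_sum; apply: eq_bigr => a _.
rewrite [LHS]tensor_eval_tens [RHS]tensor_eval_tens /=.
rewrite (rmorph_prod (comp_mpoly (linforms A))) (rmorph_prod (comp_mpoly (linforms C))).
by congr (L _ * l _); apply: eq_bigr => k _; rewrite /= comp_mpolyXU -tnth_nth tnth_linforms.
Qed.

End Tensors.

(** * A Frobenius norm bound for positive kernels with exchangeable indices *)

Section BlockKernel.
Variables (R : rcfType) (I E : finType) (S : I * E -> I * E -> R) (dl : I -> R).
Hypothesis Ssym : forall j k, S j k = S k j.
Hypothesis Spsd : forall c : I * E -> R, 0 <= \sum_j \sum_k c j * c k * S j k.
Hypothesis Sswap : forall i a i' b, S (i, a) (i', b) = S (i, b) (i', a).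

(* With [S = W^T W] and [M_lm(a, b) = sum_i dl_i W_l(i, a) W_m(i, b)], this is *)
(* [M_lm(a, b) M_lm(b, a) <= (M_lm(a, b)^2 + M_lm(b, a)^2) / 2] summed.        *)
Lemma block_kernel_frobenius_le :
  \sum_j \sum_k S j k ^+ 2 * (dl j.1 * dl k.1) <=
  \sum_i \sum_i' (\sum_a S (i, a) (i', a)) ^+ 2 * (dl i * dl i').
Proof.
have [W SW] := psd_kernel_factor Ssym Spsd.
pose M l m a b := \sum_i dl i * W l (i, a) * W m (i, b).
have MM a b a' b' : \sum_l \sum_m M l m a b * M l m a' b' =
    \sum_i \sum_i' dl i * dl i' * (S (i, a) (i', a') * S (i, b) (i', b')).
  rewrite /M; under eq_bigr => l _ do under eq_bigr => m _ do rewrite mulr_suml.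
  under eq_bigr => l _ do rewrite exchange_big /=.
  rewrite exchange_big; apply: eq_bigr => i _ /=.
  under eq_bigr => l _ do under eq_bigr => m _ do rewrite mulr_sumr.
  under eq_bigr => l _ do rewrite exchange_big /=.
  rewrite exchange_big; apply: eq_bigr => i' _ /=.
  rewrite !SW mulr_suml mulr_sumr; apply: eq_bigr => l _.
  rewrite !mulr_sumr; apply: eq_bigr => m _; ring.
(* By [Sswap] the two entries of [S] that arise are equal, whence their square. *)
have swapE a b : \sum_l \sum_m M l m a b * M l m b a =
    \sum_i \sum_i' S (i, a) (i', b) ^+ 2 * (dl i * dl i').
  rewrite MM; apply: eq_bigr => i _; apply: eq_bigr => i' _.
  rewrite [S (i, b) _]Sswap; ring.
have le_ab a b : \sum_i \sum_i' S (i, a) (i', b) ^+ 2 * (dl i * dl i') <=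
    \sum_i \sum_i' dl i * dl i' * (S (i, a) (i', a) * S (i, b) (i', b)).
  rewrite -swapE -(ler_pM2l (ltr0n _ 2)).
  have -> : 2%:R * (\sum_i \sum_i' dl i * dl i' * (S (i, a) (i', a) * S (i, b) (i', b))) =
     \sum_l \sum_m M l m a b * M l m a b + \sum_l \sum_m M l m b a * M l m b a.
    rewrite !MM mulr2n mulrDl mul1r; congr (_ + _).
    by apply: eq_bigr => i _; apply: eq_bigr => i' _; rewrite [S (i, a) _ * _]mulrC.
  rewrite mulr_sumr -big_split; apply: ler_sum => l _ /=.
  rewrite mulr_sumr -big_split; apply: ler_sum => m _ /=.
  have := sqr_ge0 (M l m a b - M l m b a); rewrite expr2; lra.
have -> : \sum_j \sum_k S j k ^+ 2 * (dl j.1 * dl k.1) =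
    \sum_a \sum_b \sum_i \sum_i' S (i, a) (i', b) ^+ 2 * (dl i * dl i').
  transitivity (\sum_i \sum_a \sum_i' \sum_b S (i, a) (i', b) ^+ 2 * (dl i * dl i')).
    rewrite [RHS]pair_bigA /=; apply: eq_bigr => -[i a] _ /=.
    by rewrite [RHS]pair_bigA /=; apply: eq_bigr => -[].
  rewrite exchange_big; apply: eq_bigr => a _ /=.
  under eq_bigr => i _ do rewrite exchange_big /=.
  by rewrite exchange_big.
apply: (@le_trans _ _ (\sum_a \sum_b \sum_i \sum_i' dl i * dl i' * (S (i, a) (i', a) * S (i, b) (i', b)))).
  by apply: ler_sum => a _; apply: ler_sum => b _; apply: le_ab.
rewrite le_eqVlt; apply/orP; left; apply/eqP.
under eq_bigr => a _ do rewrite exchange_big /=.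
rewrite exchange_big; apply: eq_bigr => i _ /=.
under eq_bigr => a _ do rewrite exchange_big /=.
rewrite exchange_big; apply: eq_bigr => i' _ /=.
rewrite expr2 !mulr_suml; apply: eq_bigr => a _.
rewrite mulr_sumr mulr_suml; apply: eq_bigr => b _; ring.
Qed.
End BlockKernel.

(** * Moment bounds for positive functionals *)

Section Core.
Variables (R : rcfType) (d s : nat).
Local Notation P := {mpoly R[d]}.
Local Notation q := (2 * s.+1)%N.

Definition sqnorm : P := \sum_i 'X_i ^+ 2.

(** An abstract expectation: only positivity is kept, so that linear changes of variables stay
    within the notion. *)
Definition positive_functional n (L : {scalar P}) :=
  forall g : P, degle n g -> (forall x, 0 <= g.@[x]) -> 0 <= L g.

(** The dual cone of the sums of squares of degree at most 2n: pseudo-expectations without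
    normalisation. *)
Definition sos_functional n (l : {scalar P}) :=
  forall h : P, degle n h -> 0 <= l (h ^+ 2).

Definition moment_bound (K : R) (L : {scalar P}) :=
  forall c, L (linform c ^+ q) <= K * (\sum_i c i ^+ 2) ^+ s.+1.

Lemma sqnorm_eval x : sqnorm.@[x] = \sum_i x i ^+ 2.
Proof. by rewrite raddf_sum; apply: eq_bigr => i _; rewrite /= rmorphXn /= mevalXU. Qed.

Lemma degle_sqnorm : degle 2 sqnorm.
Proof. by apply: degle_sum => i _; apply: (@degleX _ _ 1 2); exact: degleXU. Qed.

Section PositiveSide.
Variables (L : {scalar P}) (K : R).
Hypothesis Lpos : positive_functional q L.
Hypothesis Lbd : moment_bound K L.

Lemma positive_functional_le g h : degle q g -> degle q h ->
  (forall x, g.@[x] <= h.@[x]) -> L g <= L h.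
Proof.
move=> dg dh gh; rewrite -subr_ge0 -raddfB /=; apply: Lpos; first exact: degleB.
by move=> x; rewrite mevalB subr_ge0.
Qed.

(** A form of Hölder's inequality, from [young_power] applied to <c, x>^2 [B] and <t, x>^2 [A]; this
    scaling gives both moments the same bound K (A B)^(s+1), up to the factor [s]. *)
Lemma mixed_moment_bound (c t : 'I_d -> R) :
  L (linform c ^+ 2 * linform t ^+ (2 * s)) <=
    K * ((\sum_i c i ^+ 2) * (\sum_i t i ^+ 2) ^+ s).
Proof.
set A := \sum_i c i ^+ 2; set B := \sum_i t i ^+ 2.
have sum0 (e : 'I_d -> R) : \sum_i e i ^+ 2 = 0 -> linform e = 0.
  move=> /psumr_eq0P e0; rewrite /linform big1 // => i _.
  have /eqP := e0 (fun i _ => sqr_ge0 _) i isT.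
  by rewrite sqrf_eq0 => /eqP ->; rewrite scale0r.
have A0 : 0 <= A by apply: sumr_ge0 => i _; exact: sqr_ge0.
have B0 : 0 <= B by apply: sumr_ge0 => i _; exact: sqr_ge0.
have [Az|An] := eqVneq A 0.
  by rewrite (sum0 c Az) expr0n /= mul0r raddf0 Az mul0r mulr0.
have [Bz|Bn] := eqVneq B 0.
  (* For [s] = 0 both powers in [t] are 1, even at zero, and the bound for [c] alone is the
     claim. *)
  move: Lbd; rewrite /moment_bound; case: s => [|s'] Lbd'.
    by rewrite muln0 expr0 mulr1 expr0 mulr1; have := Lbd' c; rewrite muln1 expr1.
  by rewrite (sum0 t Bz) mulnS exprD expr0n /= mul0r mulr0 raddf0 Bz expr0n /= !mulr0.
have Agt : 0 < A by rewrite lt_def An.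
have Bgt : 0 < B by rewrite lt_def Bn.
have : L ((s.+1%:R * A ^+ s * B) *: (linform c ^+ 2 * linform t ^+ (2 * s))) <=
       L (B ^+ s.+1 *: linform c ^+ q + (s%:R * A ^+ s.+1) *: linform t ^+ q).
  apply: positive_functional_le.
  - rewrite mulnS; apply/degleZ/degleM; rewrite -[X in degle X _]mul1n; exact/degleX/degle_linform.
  - by apply: degleD; apply/degleZ; rewrite -[X in degle X _]mul1n; exact/degleX/degle_linform.
  move=> x; rewrite mevalD !mevalZ mevalM !rmorphXn /=.
  move: (meval x (linform c)) (meval x (linform t)) => a b.
  rewrite !exprM; move: (a ^+ 2) (b ^+ 2) (sqr_ge0 a) (sqr_ge0 b) => {}a {}b a0 b0.
  have := young_power s (mulr_ge0 a0 B0) (mulr_ge0 b0 A0).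
  by rewrite !exprMn; congr (_ <= _); ring.
rewrite raddfD /= !scalarZ => h.
have h1 := ler_wpM2l (exprn_ge0 s.+1 B0) (Lbd c).
have sA : 0 <= s%:R * A ^+ s.+1 by rewrite mulr_ge0 ?ler0n ?exprn_ge0.
have h2 := ler_wpM2l sA (Lbd t).
have pos : 0 < s.+1%:R * A ^+ s * B by rewrite !mulr_gt0 ?ltr0n ?exprn_gt0.
rewrite -(ler_pM2l pos); apply: le_trans h _; apply: le_trans (lerD h1 h2) _.
rewrite -/A -/B -(natr1 s) !exprS le_eqVlt; apply/orP; left; apply/eqP; ring.
Qed.

(** The source of the factor d^s. Young's inequality against |x|^2 / d, then Jensen's with weights
    [eta] and with uniform weights, give a pointwise bound by the combination [G] of the x_i^q. Each
    of these has moment at most [K], and the coefficients sum to (s + 1) d^s. *)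
Lemma weighted_norm_moment_bound (eta : 'I_d -> R) : (0 < d)%N ->
  (forall i, 0 <= eta i) -> \sum_i eta i = 1 ->
  L ((\sum_i eta i *: 'X_i ^+ 2) * sqnorm ^+ s) <= K * d%:R ^+ s.
Proof.
move=> d0 eta0 eta1.
have LX i : L ('X_i ^+ q) <= K.
  have := Lbd (fun j => (i == j)%:R).
  have -> : linform (fun j => (i == j)%:R) = 'X_i :> P.
    rewrite /linform (bigD1 i) //= eqxx scale1r big1 ?addr0 // => j.
    by rewrite eq_sym => /negPf ->; rewrite scale0r.
  rewrite (bigD1 i) //= eqxx expr1n big1 ?addr0 ?expr1n ?mulr1 // => j.
  by rewrite eq_sym => /negPf ->; rewrite expr0n.
have dn0 : d%:R != 0 :> R by rewrite pnatr_eq0 -lt0n.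
pose G : P := \sum_i (d%:R ^+ s * (eta i + s%:R / d%:R)) *: 'X_i ^+ q.
have : L (s.+1%:R *: ((\sum_i eta i *: 'X_i ^+ 2) * sqnorm ^+ s)) <= L G.
  apply: positive_functional_le.
  - rewrite mulnS; apply/degleZ/degleM; last exact/degleX/degle_sqnorm.
    by apply: degle_sum => i _; apply/degleZ/(@degleX _ _ 1 2)/degleXU.
  - by apply: degle_sum => i _; apply/degleZ; rewrite -[X in degle X _]mul1n; exact/degleX/degleXU.
  move=> x; rewrite mevalZ mevalM rmorphXn /= sqnorm_eval /G !raddf_sum /=.
  under eq_bigr do rewrite mevalZ rmorphXn /= mevalXU.
  under [X in _ <= X]eq_bigr do rewrite mevalZ rmorphXn /= mevalXU exprM.
  set u := \sum_i _; set w := \sum_i x i ^+ 2.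
  have u0 : 0 <= u by apply: sumr_ge0 => i _; rewrite mulr_ge0 ?sqr_ge0.
  have w0 : 0 <= w by apply: sumr_ge0 => i _; rewrite sqr_ge0.
  have wE : w / d%:R = \sum_i (d%:R^-1) * x i ^+ 2 by rewrite -mulr_sumr mulrC.
  have := young_power s u0 (divr_ge0 w0 (ler0n _ d)).
  have J1 := @jensen_power _ _ eta (fun i => x i ^+ 2) s eta0 eta1 (fun i => sqr_ge0 _).
  have J2 := @jensen_power _ _ (fun=> d%:R^-1) (fun i => x i ^+ 2) s.
  have {}J2 : (w / d%:R) ^+ s.+1 <= \sum_i d%:R^-1 * (x i ^+ 2) ^+ s.+1.
    rewrite wE; apply: J2 => [i||i]; rewrite ?invr_ge0 ?ler0n ?sqr_ge0 //.
    by rewrite sumr_const card_ord -(mulr_natl (d%:R^-1)) mulfV.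
  have {}J2 := ler_wpM2l (ler0n _ s) J2.
  move=> Y; have {Y J1 J2}Y := le_trans Y (lerD J1 J2).
  have := ler_wpM2l (exprn_ge0 s (ler0n R d)) Y.
  have -> : d%:R ^+ s * (s.+1%:R * (u * (w / d%:R) ^+ s)) = s.+1%:R * (u * w ^+ s).
    by rewrite expr_div_n; field; rewrite expf_neq0.
  congr (_ <= _); rewrite mulr_sumr -big_split mulr_sumr; apply: eq_bigr => i _ /=; ring.
rewrite scalarZ raddf_sum /= => h.
have {}h : s.+1%:R * L ((\sum_i eta i *: 'X_i ^+ 2) * sqnorm ^+ s) <= s.+1%:R * (K * d%:R ^+ s).
  apply: le_trans h _.
  apply: (@le_trans _ _ (\sum_i (d%:R ^+ s * (eta i + s%:R / d%:R)) * K)).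
    apply: ler_sum => i _; rewrite scalarZ ler_wpM2l //.
    by rewrite mulr_ge0 ?exprn_ge0 ?addr_ge0 ?divr_ge0 ?ler0n.
  rewrite -mulr_suml -mulr_sumr big_split /= eta1 sumr_const card_ord -(mulr_natl (s%:R / d%:R)).
  rewrite -(natr1 s) le_eqVlt; apply/orP; left; apply/eqP; field.
  exact: dn0.
by move: h; rewrite ler_pM2l ?ltr0n.
Qed.
End PositiveSide.
End Core.

(** * The bound on the pairing, by Cauchy-Schwarz in a diagonalising basis *)

Section Duality.
Variables (R : rcfType) (d s : nat).
Local Notation P := {mpoly R[d]}.
Local Notation q := (2 * s.+1)%N.
Local Notation sqnorm := (sqnorm R d).
Local Notation J := ('I_d * {ffun 'I_s -> 'I_d})%type.

(* The monomials of degree [s + 1], one for each word of length [s + 1] whose *)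
(* first letter is singled out.                                               *)
Definition word (j : J) : P := 'X_(j.1) * \prod_k 'X_(j.2 k).

Lemma word_eval j x : (word j).@[x] = x j.1 * \prod_k x (j.2 k).
Proof.
rewrite /word mevalM mevalXU (rmorph_prod (meval x)); congr (_ * _).
by apply: eq_bigr => k _; exact: mevalXU.
Qed.

Lemma degle_word j : degle s.+1 (word j).
Proof.
rewrite -[s.+1]add1n; apply: degleM; first exact: degleXU.
have es : (\sum_(k < s) 1)%N = s by rewrite sum1_card card_ord.
by rewrite -[X in degle X _]es; apply: degle_prod => k; exact: degleXU.
Qed.

(** <x, v>^q is the square of <x, v>^(s+1), which expands over words. *)
Lemma pairing_exprE (L l : {scalar P}) :
  tensor_eval L l (pairing R d ^+ q) =
  \sum_j \sum_k L (word j * word k) * l (word j * word k).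
Proof.
have e1 : pairing R d ^+ s.+1 = \sum_j tens (word j) (word j).
  rewrite exprS [pairing R d ^+ s]expr_sum_tens /pairing mulr_suml.
  rewrite -[RHS](pair_bigA _ (fun i a => tens (word (i, a)) (word (i, a)))) /=.
  by apply: eq_bigr => i _; rewrite mulr_sumr; apply: eq_bigr => a _; rewrite tensM.
have -> : pairing R d ^+ q = \sum_j \sum_k tens (word j * word k) (word j * word k).
  rewrite mulnC exprM e1 expr2 mulr_suml; apply: eq_bigr => j _.
  by rewrite mulr_sumr; apply: eq_bigr => k _; rewrite tensM.
rewrite tensor_eval_sum; apply: eq_bigr => j _.
by rewrite tensor_eval_sum; apply: eq_bigr => k _; rewrite tensor_eval_tens.
Qed.

Section PrimalSide.
Variables (L : {scalar P}) (K : R) (gm : 'I_d -> R).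
Hypothesis Lpos : positive_functional q L.
Hypothesis Lbd : moment_bound s K L.
Hypothesis K0 : 0 <= K.
Hypothesis d0 : (0 < d)%N.
Hypothesis gm1 : \sum_i gm i ^+ 2 = 1.

(** The left side applies [L] in [x] and in an independent copy x'. With [x] fixed,
    [mixed_moment_bound] treats x'; then [weighted_norm_moment_bound] with weights gm_i^2 treats
    [x]. *)
Lemma primal_weighted_norm_le :
  \sum_j \sum_k L (word j * word k) ^+ 2 * (gm j.1 * gm k.1) <=
    K ^+ 2 * d%:R ^+ s.
Proof.
pose T j k := L (word j * word k).
(* Of the two factors [T], one already has [L] applied and the other is left as a polynomial in
   [x]. *)
pose P0 : P := \sum_j \sum_k (gm j.1 * gm k.1 * T j k) *: (word j * word k).
have LP0 : L P0 = \sum_j \sum_k T j k ^+ 2 * (gm j.1 * gm k.1).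
  rewrite raddf_sum; apply: eq_bigr => j _; rewrite raddf_sum; apply: eq_bigr => k _.
  rewrite [LHS]scalarZ -/(T j k); ring.
rewrite -LP0.
have degww j k : degle q (word j * word k).
  by rewrite mul2n -addnn; apply: degleM; exact: degle_word.
pose N : P := K *: ((\sum_i gm i ^+ 2 *: 'X_i ^+ 2) * sqnorm ^+ s).
have -> : K ^+ 2 * d%:R ^+ s = K * (K * d%:R ^+ s) by ring.
apply: (@le_trans _ _ (L N)); last first.
  rewrite scalarZ ler_wpM2l //; apply: weighted_norm_moment_bound => // i.
  exact: sqr_ge0.
apply: (positive_functional_le Lpos).
- by apply: degle_sum => j _; apply: degle_sum => k _; apply: degleZ.
- apply: degleZ; rewrite mulnS; apply: degleM; last exact/degleX/degle_sqnorm.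
  by apply: degle_sum => i _; apply/degleZ/(@degleX _ _ 1 2)/degleXU.
move=> x.
(* At a fixed point [x], the value of [P0] is [L] of the square of (sum_i gm_i x_i x'_i) <x,
   x'>^s. *)
pose e : P := linform (fun i => gm i * x i) * linform x ^+ s.
have eE : e = \sum_j (gm j.1 * (word j).@[x]) *: word j.
  rewrite /e {2}/linform expr_sum_distr /linform mulr_suml.
  rewrite -[RHS](pair_bigA _ (fun i a => (gm i * (word (i, a)).@[x]) *: word (i, a))) /=.
  apply: eq_bigr => i _; rewrite mulr_sumr; apply: eq_bigr => a _.
  rewrite word_eval /word /= scaler_prod mpoly_scaleM.
  by congr (_ *: _); ring.
have -> : P0.@[x] = L (e ^+ 2).
  rewrite expr2 eE mulr_suml (raddf_sum (meval x)) (raddf_sum L).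
  apply: eq_bigr => j _; rewrite (raddf_sum (meval x)) mulr_sumr (raddf_sum L).
  apply: eq_bigr => k _; rewrite [LHS]mevalZ mevalM mpoly_scaleM.
  rewrite [RHS]scalarZ -/(T j k); ring.
have -> : e ^+ 2 = linform (fun i => gm i * x i) ^+ 2 * linform x ^+ (2 * s).
  by rewrite exprMn -exprM mulnC.
apply: le_trans (mixed_moment_bound Lpos Lbd _ _) _.
rewrite mevalZ mevalM rmorphXn /= sqnorm_eval (raddf_sum (meval x)).
rewrite (eq_bigr (fun i => (gm i ^+ 2 *: 'X_i ^+ 2).@[x])) // => i _.
by rewrite mevalZ rmorphXn /= mevalXU exprMn.
Qed.
End PrimalSide.

Section DualSide.
Variables (l : {scalar P}) (dl : 'I_d -> R).
Hypothesis lpsd : sos_functional s.+1 l.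

(** The block kernel inequality for S = l(v_i v_a v_i' v_b): exchanging [a] and [b] leaves the
    product unchanged, and summing the entries with a = b produces |v|^(2s). *)
Lemma dual_weighted_norm_le :
  \sum_j \sum_k l (word j * word k) ^+ 2 * (dl j.1 * dl k.1) <=
  \sum_i \sum_i' l ('X_i * 'X_i' * sqnorm ^+ s) ^+ 2 * (dl i * dl i').
Proof.
have := @block_kernel_frobenius_le R _ _ (fun j k => l (word j * word k)) dl _ _ _.
have -> : \sum_i \sum_i' (\sum_a l (word (i, a) * word (i', a))) ^+ 2 * (dl i * dl i') =
     \sum_i \sum_i' l ('X_i * 'X_i' * sqnorm ^+ s) ^+ 2 * (dl i * dl i').
  apply: eq_bigr => i _; apply: eq_bigr => i' _; congr (_ ^+ 2 * _).
  rewrite -(raddf_sum l); congr (l _).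
  rewrite /sqnorm expr_sum_distr mulr_sumr; apply: eq_bigr => a _.
  rewrite /word /= mulrACA -big_split /=; congr (_ * _).
apply.
- by move=> j k; rewrite mulrC.
- move=> c; have := lpsd (h := \sum_j c j *: word j) _.
  have -> : l ((\sum_j c j *: word j) ^+ 2) = \sum_j \sum_k c j * c k * l (word j * word k).
    rewrite expr2 mulr_suml (raddf_sum l); apply: eq_bigr => j _.
    rewrite mulr_sumr (raddf_sum l); apply: eq_bigr => k _.
    by rewrite mpoly_scaleM [LHS]scalarZ.
  by apply; apply: degle_sum => j _; apply/degleZ/degle_word.
- by move=> i a i' b; congr (l _); rewrite /word /=; ring.
Qed.

(** The argument of [l] is the sum of the squares of the words starting with [i]. *)
Lemma dual_marginal_ge0 i : 0 <= l ('X_i ^+ 2 * sqnorm ^+ s).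
Proof.
rewrite /sqnorm expr_sum_distr mulr_sumr (raddf_sum l); apply: sumr_ge0 => a _.
by rewrite prodrXl -exprMn; exact: (lpsd (degle_word (i, a))).
Qed.
End DualSide.

Lemma pairing_bound_diag (L l : {scalar P}) (K : R) : (0 < d)%N -> 0 <= K ->
  positive_functional q L -> moment_bound s K L -> sos_functional s.+1 l ->
  (forall i j, i != j -> l ('X_i * 'X_j * sqnorm ^+ s) = 0) ->
  tensor_eval L l (pairing R d ^+ q) ^+ 2 <=
    K ^+ 2 * d%:R ^+ s * l (sqnorm ^+ s.+1) ^+ 2.
Proof.
move=> d0 K0 Lpos Lbd lpsd lD.
pose ka i := l ('X_i ^+ 2 * sqnorm ^+ s); pose N := l (sqnorm ^+ s.+1).
have ka0 i : 0 <= ka i by exact: dual_marginal_ge0.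
have NE : N = \sum_i ka i.
  by rewrite /N exprS {1}/sqnorm mulr_suml (raddf_sum l).
have N0 : 0 <= N by rewrite NE sumr_ge0.
have dgt : 0 < d%:R :> R by rewrite ltr0n.
rewrite -/N; set V := tensor_eval _ _ _; set M := K ^+ 2 * d%:R ^+ s.
have M0 : 0 <= M by rewrite mulr_ge0 ?sqr_ge0 ?exprn_ge0 ?ler0n.
(* Some [ka i] may vanish while Cauchy-Schwarz divides by the weights: add [eps] to each, normalise
   by the new total [Z], and let [eps] tend to 0 at the end. *)
have Veps eps : 0 < eps -> V ^+ 2 <= M * N ^+ 2 + eps * (M * N * d%:R).
  move=> e0; pose Z := N + d%:R * eps.
  have Z0 : 0 < Z by rewrite ltr_wpDl // mulr_gt0.
  pose eta i := (ka i + eps) / Z.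
  have eta_gt i : 0 < eta i by rewrite divr_gt0 // ltr_wpDl.
  pose gm i := Num.sqrt (eta i).
  have gm_gt i : 0 < gm i by rewrite sqrtr_gt0.
  have gm2 i : gm i ^+ 2 = eta i by rewrite sqr_sqrtr // ltW.
  have eta1 : \sum_i eta i = 1.
    rewrite -mulr_suml big_split /= -NE sumr_const card_ord -(mulr_natl eps).
    by rewrite mulfV // gt_eqF.
  have := @weighted_cauchy_schwarz _ _ (fun p : J * J => l (word p.1 * word p.2))
    (fun p => L (word p.1 * word p.2)) (fun p => gm p.1.1 * gm p.2.1) _.
  rewrite -(pair_bigA _ (fun j k => l (word j * word k) * L (word j * word k))).
  rewrite -(pair_bigA _ (fun j k => l (word j * word k) ^+ 2 / (gm j.1 * gm k.1))).
  rewrite -(pair_bigA _ (fun j k => L (word j * word k) ^+ 2 * (gm j.1 * gm k.1))) /=.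
  have -> : \sum_j \sum_k l (word j * word k) * L (word j * word k) = V.
    rewrite /V pairing_exprE; apply: eq_bigr => j _; apply: eq_bigr => k _.
    exact: mulrC.
  move=> /(_ (fun p => mulr_gt0 (gm_gt _) (gm_gt _))) CS.
  apply: le_trans CS _.
  apply: (@le_trans _ _ ((Z * N) * M)); last first.
    by rewrite /Z le_eqVlt; apply/orP; left; apply/eqP; ring.
  apply: ler_pM.
  - apply: sumr_ge0 => j _; apply: sumr_ge0 => k _.
    by rewrite divr_ge0 ?sqr_ge0 ?mulr_ge0 // ltW.
  - apply: sumr_ge0 => j _; apply: sumr_ge0 => k _.
    by rewrite mulr_ge0 ?sqr_ge0 ?mulr_ge0 // ltW.
  - have -> : \sum_j \sum_k l (word j * word k) ^+ 2 / (gm j.1 * gm k.1) =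
      \sum_j \sum_k l (word j * word k) ^+ 2 * ((gm j.1)^-1 * (gm k.1)^-1).
      by apply: eq_bigr => j _; apply: eq_bigr => k _; rewrite invfM.
    apply: le_trans (dual_weighted_norm_le (fun i => (gm i)^-1) lpsd) _.
    rewrite NE mulr_sumr; apply: ler_sum => i _.
    (* Only i = i' survives, by diagonality; its term ka_i^2 / eta_i is [Z * ka i] times a ratio at
       most 1. *)
    rewrite (bigD1 i) //= big1 ?addr0 => [|j ji]; last first.
      by rewrite lD 1?eq_sym // expr0n /= mul0r.
    rewrite -expr2 -/(ka i) -invfM -expr2 gm2 /eta invfM invrK.
    have ke0 : 0 < ka i + eps by rewrite ltr_wpDl.
    rewrite [X in X <= _](_ : _ = Z * ka i * (ka i / (ka i + eps))); last by ring.
    rewrite ler_piMr ?mulr_ge0 ?(ltW Z0) // ler_pdivrMr // mul1r lerDl.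
    exact: ltW.
  - by apply: primal_weighted_norm_le => //; under eq_bigr do rewrite gm2.
apply/ler_addgt0Pr => e e0.
have Y0 : 0 <= M * N * d%:R := mulr_ge0 (mulr_ge0 M0 N0) (ltW dgt).
have Y1 : 0 < M * N * d%:R + 1 by rewrite ltr_wpDl ?ltr01.
apply: le_trans (Veps (e / (M * N * d%:R + 1)) (divr_gt0 e0 Y1)) _.
by rewrite lerD2l mulrAC ler_pdivrMr // ler_pM2l // lerDl ler01.
Qed.

Lemma comp_positive_functional (L : {scalar P}) (A : 'M[R]_d) n :
  positive_functional n L -> positive_functional n (L \o comp_mpoly (linforms A)).
Proof.
move=> Lpos g dg g0 /=; apply: Lpos => [|x]; last by rewrite comp_mpoly_meval.
by apply: degle_comp dg => i; rewrite tnth_linforms; exact: degle_linform.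
Qed.

Lemma comp_sos_functional (l : {scalar P}) (A : 'M[R]_d) n :
  sos_functional n l -> sos_functional n (l \o comp_mpoly (linforms A)).
Proof.
move=> lpsd h dh /=; rewrite rmorphXn; apply: lpsd.
by apply: degle_comp dh => i; rewrite tnth_linforms; exact: degle_linform.
Qed.

Lemma linform_mul (c e : 'I_d -> R) :
  linform c * linform e = \sum_i \sum_j (c i * e j) *: ('X_i * 'X_j) :> P.
Proof.
rewrite /linform mulr_suml; apply: eq_bigr => i _.
rewrite mulr_sumr; apply: eq_bigr => j _.
by rewrite mpoly_scaleM.
Qed.

Lemma comp_sqnorm (A : 'M[R]_d) :
  sqnorm \mPo linforms A = \sum_i \sum_j (A^T *m A) i j *: ('X_i * 'X_j).
Proof.
rewrite (raddf_sum (comp_mpoly (linforms A))) /=.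
transitivity (\sum_i linform (A i) * linform (A i)).
  apply: eq_bigr => i _; rewrite rmorphXn /= comp_mpolyXU -tnth_nth tnth_linforms.
  by rewrite expr2.
rewrite (eq_bigr _ (fun i _ => linform_mul (A i) (A i))).
rewrite exchange_big; apply: eq_bigr => i _ /=.
rewrite exchange_big; apply: eq_bigr => j _ /=.
rewrite -scaler_suml mxE; congr (_ *: _).
by apply: eq_bigr => k _; rewrite mxE.
Qed.

Lemma comp_sqnorm_orthogonal (U : 'M[R]_d) :
  U^T *m U = 1%:M -> sqnorm \mPo linforms U = sqnorm.
Proof.
move=> UU; rewrite comp_sqnorm UU; apply: eq_bigr => i _.
rewrite (bigD1 i) //= big1 ?addr0 => [|j ji]; last first.
  by rewrite mxE eq_sym (negPf ji) scale0r.
by rewrite mxE eqxx scale1r expr2.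
Qed.

Lemma comp_moment_bound (L : {scalar P}) (K : R) (U : 'M[R]_d) :
  U *m U^T = 1%:M -> moment_bound s K L ->
  moment_bound s K (L \o comp_mpoly (linforms U)).
Proof.
move=> UU Lbd c /=; rewrite rmorphXn /= comp_linform.
apply: le_trans (Lbd _) _.
suff -> : \sum_i (\sum_k c k * U k i) ^+ 2 = \sum_i c i ^+ 2 by [].
transitivity (((\row_i c i) *m U *m (\row_i c i *m U)^T) 0 0).
  rewrite mxE; apply: eq_bigr => i _; rewrite expr2 [_^T _ _]mxE mxE.
  by congr (_ * _); apply: eq_bigr => k _; rewrite mxE.
rewrite trmx_mul mulmxA -[_ *m U *m U^T]mulmxA UU mulmx1 mxE.
by apply: eq_bigr => i _; rewrite !mxE expr2.
Qed.

(** An orthogonal change of both groups of variables preserves the pairing, |v|^2 and all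
    hypotheses; choosing it to diagonalise [Q] reduces to [pairing_bound_diag]. *)
Theorem pairing_bound (L l : {scalar P}) (K : R) : (0 < d)%N -> 0 <= K ->
  positive_functional q L -> moment_bound s K L -> sos_functional s.+1 l ->
  tensor_eval L l (pairing R d ^+ q) ^+ 2 <=
    K ^+ 2 * d%:R ^+ s * l (sqnorm ^+ s.+1) ^+ 2.
Proof.
move=> d0 K0 Lpos Lbd lpsd.
pose Q := \matrix_(i, j) l ('X_i * 'X_j * sqnorm ^+ s).
have [|U [k [UU UQ]]] := @symmetric_diagonalization _ _ Q.
  by apply/matrixP => i j; rewrite !mxE ['X_i * _]mulrC.
have UU' : U^T *m U = 1%:M by apply: mulmx1C.
rewrite -(tensor_eval_comp L l q UU').
have -> : l (sqnorm ^+ s.+1) = (l \o comp_mpoly (linforms U)) (sqnorm ^+ s.+1).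
  by rewrite /= rmorphXn /= comp_sqnorm_orthogonal.
apply: pairing_bound_diag => //.
- exact: comp_positive_functional.
- exact: comp_moment_bound.
- exact: comp_sos_functional.
move=> i j ij /=; rewrite !rmorphM rmorphXn /= comp_sqnorm_orthogonal //.
rewrite !comp_mpolyXU -!tnth_nth !tnth_linforms linform_mul.
move/matrixP: UQ => /(_ i j); rewrite [RHS]mxE (negPf ij) mulr0n => <-.
rewrite mulr_suml (raddf_sum l) /= [RHS]mxE.
transitivity (\sum_a \sum_b U i a * U j b * Q a b).
  apply: eq_bigr => a _; rewrite mulr_suml (raddf_sum l).
  by apply: eq_bigr => b _; rewrite -scalerAl [LHS]scalarZ mxE.
rewrite exchange_big; apply: eq_bigr => b _ /=.
rewrite [in RHS]mxE mulr_suml; apply: eq_bigr => a _.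
by rewrite [U^T _ _]mxE mulrAC.
Qed.
End Duality.

(** * Functionals given by their values on monomials *)

Section CoefficientFunctional.
Variables (R : rcfType) (d n : nat).
Local Notation P := {mpoly R[d]}.

(** Monomials of degree [n] or more are sent to 0, so that a finite sum defines a functional on all
    polynomials. *)
Definition coeff_functional (c : 'X_{1..d} -> R) (p : P) : R :=
  \sum_(m : 'X_{1..d < n}) c m * p@_m.

Lemma coeff_functional_is_linear c :
  linear_for *%R (coeff_functional c).
Proof.
move=> a p p'; rewrite /coeff_functional mulr_sumr -big_split /=.
by apply: eq_bigr => m _; rewrite mcoeffD mcoeffZ mulrDr mulrCA.
Qed.

HB.instance Definition _ c := GRing.isLinear.Build R P R *%R
  (coeff_functional c) (coeff_functional_is_linear c).

Lemma coeff_functionalX c m : (mdeg m < n)%N -> coeff_functional c 'X_[m] = c m.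
Proof.
move=> mn; rewrite /coeff_functional (bigD1 (BMultinom mn)) //= mcoeffX eqxx mulr1.
rewrite big1 ?addr0 // => m' mm'; rewrite mcoeffX.
by move: mm'; rewrite bmeqP eq_sym => /negPf ->; rewrite mulr0.
Qed.
End CoefficientFunctional.

(** * A functional on squares that controls the coefficients of the root *)

Section Coercivity.
Variables (R : rcfType) (d r : nat).
Local Notation P := {mpoly R[d]}.
Local Notation J := 'X_{1..d < r.+1}.

Definition mnorm2 (m : 'X_{1..d}) : nat := (\sum_i m i ^ 2)%N.

(** The parallelogram law; strictness gains a factor [t] off the diagonal below. *)
Lemma mnorm2_addn_lt (m m' : 'X_{1..d}) : m != m' ->
  (mnorm2 (m + m') < 2 * mnorm2 m + 2 * mnorm2 m')%N.
Proof.
move=> mm'.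
have [i mi] : exists i, m i != m' i.
  by apply/existsP; apply: contraNT mm' => /existsPn h; apply/eqP/mnmP => i; apply/eqP/negbNE/h.
have : (\sum_i ((m + m')%MM i ^ 2 + (m i != m' i)) <= \sum_i (2 * m i ^ 2 + 2 * m' i ^ 2))%N.
  by apply: leq_sum => j _; rewrite mnmDE; case: eqVneq => [->|h]; nia.
have d2 (a : 'X_{1..d}) : (2 * mnorm2 a = \sum_i 2 * a i ^ 2)%N by rewrite big_distrr.
rewrite !d2 -big_split; apply: leq_trans; rewrite big_split /=.
by rewrite -addn1 leq_add2l (bigD1 i) //= mi leq_addr.
Qed.

(* The Hankel-type matrix [t ^ |m + m'|^2] is diagonally dominant after        *)
(* rescaling since [|m + m'|^2 = 2 |m|^2 + 2 |m'|^2 - |m - m'|^2].              *)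
Lemma exists_coercive_functional :
  exists tau : 'X_{1..d} -> R, (forall m, 0 <= tau m) /\
    forall c : J -> R, \sum_j c j ^+ 2 <=
      2 * coeff_functional (2 * r).+1 tau ((\sum_j c j *: 'X_[j]) ^+ 2).
Proof.
(* After rescaling, off-diagonal entries are at most 1/t against a unit diagonal; as t > 2n, at
   least half of the diagonal form remains. *)
pose n := #|{: J}|; pose t : R := (2 * n).+1%:R.
have t1 : 1 <= t by rewrite /t ler1n.
have t0 : 0 < t by exact: lt_le_trans ltr01 t1.
exists (fun m => t ^+ mnorm2 m); split=> [m|c]; first by rewrite exprn_ge0 // ltW.
pose l0 : {scalar P} := coeff_functional (2 * r).+1 (fun m => t ^+ mnorm2 m).
rewrite -[coeff_functional _ _]/(l0 : P -> R).
have l0E : l0 ((\sum_j c j *: 'X_[j]) ^+ 2) =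
    \sum_j \sum_k c j * c k * t ^+ mnorm2 (j + k)%MM.
  rewrite expr2 mulr_suml (raddf_sum l0); apply: eq_bigr => j _.
  rewrite mulr_sumr (raddf_sum l0); apply: eq_bigr => k _.
  rewrite mpoly_scaleM -mpolyXD [LHS]scalarZ.
  rewrite [l0 _]coeff_functionalX // mdegD mul2n -addnn ltnS leq_add // -ltnS; exact: bmdeg.
pose b j := `|c j| * t ^+ (2 * mnorm2 j).
have b0 j : 0 <= b j by rewrite mulr_ge0 // exprn_ge0 // ltW.
have cb j : c j ^+ 2 <= b j ^+ 2.
  rewrite -[c j ^+ 2]real_normK ?num_real // lerXn2r ?nnegrE //.
  by rewrite ler_peMr // exprn_ege1.
have term j k : (j == k)%:R * (t * b j ^+ 2) - b j * b k <=
    t * (c j * c k * t ^+ mnorm2 (j + k)%MM).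
  have [<-|jk] := eqVneq j k.
    have -> : mnorm2 (j + j)%MM = (2 * mnorm2 j + 2 * mnorm2 j)%N.
      rewrite /mnorm2 -mulnDr addnn -mul2n mulnA big_distrr /=.
      by apply: eq_bigr => i _; rewrite mnmDE; nia.
    have -> : t * (c j * c j * t ^+ (2 * mnorm2 j + 2 * mnorm2 j)) = t * b j ^+ 2.
      rewrite /b exprMn real_normK ?num_real // exprD; ring.
    by rewrite mul1r -expr2 gerBl sqr_ge0.
  rewrite mul0r add0r lerNl -mulrN -mulNr.
  apply: (@le_trans _ _ (`|c j| * `|c k| * (t * t ^+ mnorm2 (j + k)%MM))).
    rewrite [leRHS]mulrCA; apply: ler_wpM2l; first exact: ltW.
    apply: ler_wpM2r; first by rewrite exprn_ge0 // ltW.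
    by rewrite -normrM -normrN ler_norm.
  rewrite /b [leRHS]mulrACA -exprD -exprS; apply: ler_wpM2l; first by rewrite mulr_ge0.
  by rewrite ler_weXn2l // mnorm2_addn_lt // -bmeqP.
have sumle : t * (\sum_j b j ^+ 2) - \sum_j \sum_k b j * b k <=
    t * l0 ((\sum_j c j *: 'X_[j]) ^+ 2).
  rewrite l0E mulr_sumr -sumrB mulr_sumr; apply: ler_sum => j _.
  rewrite mulr_sumr; apply: le_trans (ler_sum _ (fun k _ => term j k)).
  rewrite sumrB lerD2r (bigD1 j) //= eqxx mul1r big1 ?addr0 // => k.
  by rewrite eq_sym => /negPf ->; rewrite mul0r.
have bb : \sum_j \sum_k b j * b k <= n%:R * \sum_j b j ^+ 2.
  apply: (@le_trans _ _ (\sum_j \sum_k (b j ^+ 2 + b k ^+ 2) / 2)).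
    apply: ler_sum => j _; apply: ler_sum => k _.
    by have := sqr_ge0 (b j - b k); rewrite !expr2; lra.
  rewrite le_eqVlt; apply/orP; left; apply/eqP.
  have -> : \sum_j \sum_k (b j ^+ 2 + b k ^+ 2) / 2 =
     (\sum_j \sum_(k : J) b j ^+ 2 + \sum_(j : J) \sum_k b k ^+ 2) / 2.
    rewrite -big_split mulr_suml; apply: eq_bigr => j _ /=.
    by rewrite -big_split mulr_suml.
  rewrite [X in _ + X]exchange_big /=.
  have -> : \sum_j \sum_(k : J) b j ^+ 2 = n%:R * \sum_j b j ^+ 2.
    by rewrite mulr_sumr; apply: eq_bigr => j _; rewrite sumr_const [RHS]mulr_natl.
  lra.
apply: (@le_trans _ _ (\sum_j b j ^+ 2)); first by apply: ler_sum => j _.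
have B0 : 0 <= \sum_j b j ^+ 2 by apply: sumr_ge0 => j _; exact: sqr_ge0.
rewrite -(ler_pM2l t0).
move: sumle bb B0; move: (\sum_j b j ^+ 2) (\sum_j _) (l0 _) => B C D.
rewrite /t -(natr1 (2 * n)) natrM; move: (n%:R : R) (ler0n R n) => N N0; nra.
Qed.
End Coercivity.

(** * Projection onto the cone of sums of squares, and separation from it *)

Section Separation.
Local Open Scope classical_set_scope.
Variables (R : realType) (d r : nat).
Local Notation P := {mpoly R[d]}.
Local Notation J := 'X_{1..d < r.+1}.
Local Notation J2 := 'X_{1..d < (2 * r).+1}.
Local Notation n := #|{: J}|.

(** The quadratic form of the Gram matrix [G] at the vector of monomials; a positive semidefinite
    [G] gives a sum of squares. *)
Definition gram_poly (G : J -> J -> R) : P :=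
  \sum_j \sum_k G j k *: ('X_[j] * 'X_[k]).

Definition coeff_dist (f p : P) : R := \sum_(m : J2) ((f - p)@_m) ^+ 2.

Lemma gram_polyD (G H : J -> J -> R) (a : R) :
  gram_poly (fun j k => G j k + a * H j k) = gram_poly G + a *: gram_poly H.
Proof.
rewrite /gram_poly scaler_sumr -big_split; apply: eq_bigr => j _ /=.
rewrite scaler_sumr -big_split; apply: eq_bigr => k _ /=.
by rewrite scalerDl scalerA.
Qed.

Lemma gram_poly_sqr (c : J -> R) :
  gram_poly (fun j k => c j * c k) = (\sum_j c j *: 'X_[j]) ^+ 2.
Proof.
rewrite expr2 mulr_suml; apply: eq_bigr => j _.
rewrite mulr_sumr; apply: eq_bigr => k _.
by rewrite mpoly_scaleM.
Qed.

Lemma gram_poly_factor (I : finType) (W : I -> J -> R) :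
  gram_poly (fun j k => \sum_i W i j * W i k) =
  \sum_i (\sum_j W i j *: 'X_[j]) ^+ 2.
Proof.
under [RHS]eq_bigr do rewrite -gram_poly_sqr.
rewrite /gram_poly [RHS]exchange_big; apply: eq_bigr => j _ /=.
rewrite [RHS]exchange_big; apply: eq_bigr => k _ /=.
by rewrite scaler_suml.
Qed.

Lemma quadratic_nonneg_slope (a b : R) :
  (forall t, 0 < t <= 1 -> 0 <= t * a + t ^+ 2 * b) -> 0 <= a.
Proof.
move=> h; rewrite leNgt; apply/negP => a0.
have [b0|b0] := leP b 0.
  have := h 1; rewrite ltr01 lexx => /(_ isT); nra.
pose t := Num.min 1 (- a / (2 * b)).
have t0 : 0 < t by rewrite lt_min ltr01 divr_gt0 //; lra.
have t1 : t <= 1 by rewrite ge_min lexx.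
have := h t; rewrite t0 t1 => /(_ isT).
rewrite expr2 -mulrA -mulrDr pmulr_rge0 //.
have : t <= - a / (2 * b) by rewrite ge_min lexx orbT.
rewrite ler_pdivlMr; nra.
Qed.

(** The coefficients of all the squares are stored in one row vector, for compactness and the
    extreme value theorem. *)
Definition rowW (v : 'rV[R]_#|{: 'I_n * J}|) (i : 'I_n) (j : J) : R :=
  v 0 (enum_rank (i, j)).

(** Here [n] squares suffice, since a positive kernel on [J] factors with [n] rows. *)
Definition sqpoly (W : 'I_n -> J -> R) : P := \sum_i (\sum_j W i j *: 'X_[j]) ^+ 2.

Lemma coeff_dist_continuous (f : P) :
  continuous (fun v => coeff_dist f (sqpoly (rowW v))).
Proof.
rewrite /coeff_dist.
have csum (T : finType) (F : T -> 'rV[R]_#|{: 'I_n * J}| -> R) :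
    (forall i, continuous (F i)) -> continuous (fun v => \sum_i F i v).
  by move=> cF; apply: continuous_big => //; exact: add_continuous.
apply: (csum _) => m.
have cm : continuous (fun v => (f - sqpoly (rowW v))@_m).
  have -> : (fun v => (f - sqpoly (rowW v))@_m) = (fun v => f@_m +
     \sum_i \sum_(j : J) \sum_(k : J) (- ('X_[j] * 'X_[k] : P)@_m) * (rowW v i j * rowW v i k)).
    apply/funext => v; rewrite mcoeffB raddf_sum /= -sumrN; congr (_ + _).
    apply: eq_bigr => i _; rewrite -gram_poly_sqr raddf_sum /= -sumrN.
    apply: eq_bigr => j _; rewrite raddf_sum /= -sumrN; apply: eq_bigr => k _.
    by rewrite mcoeffZ mulNr mulrC.
  have crow i j : continuous (fun v => rowW v i j) by move=> v; exact: coord_continuous.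
  have cs : continuous (fun v => \sum_i \sum_(j : J) \sum_(k : J)
      (- ('X_[j] * 'X_[k] : P)@_m) * (rowW v i j * rowW v i k)).
    apply: (csum _ (fun i v => \sum_(j : J) \sum_(k : J) _)) => i.
    apply: (csum _ (fun j v => \sum_(k : J) _)) => j.
    apply: (csum _ (fun k v => _)) => k v.
    exact: (cvgM (cvg_cst _) (cvgM (crow i j v) (crow i k v))).
  by move=> v; exact: (cvgD (cvg_cst _) (cs v)).
move=> v; rewrite (_ : (fun v => (_ : R) ^+ 2) = (fun v => (f - sqpoly (rowW v))@_m * (f - sqpoly (rowW v))@_m)).
  exact: (cvgM (cm v) (cm v)).
by apply/funext => u; rewrite expr2.
Qed.

(** Candidates no better than 0 lie at distance more than or equal to [F]; the others have bounded
    coefficients, hence by coercivity lie in a compact box, on which the distance attains its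
    minimum. *)
Lemma exists_closest_gram (f : P) :
  exists W : 'I_n -> J -> R, forall W',
    coeff_dist f (sqpoly W) <= coeff_dist f (sqpoly W').
Proof.
have [tau [tau0 coer]] := exists_coercive_functional R d r.
pose F := coeff_dist f 0.
(* Within distance [F] a coefficient [b] satisfies b^2 <= 4F, so b <= 1 + 4F; coercivity then bounds
   the sum of the squares of the entries by [M0], and each entry by [M]. *)
pose M0 := 2 * \sum_(m : J2) tau m * (1 + 4 * F).
pose M := 1 + M0.
have F0 : 0 <= F by apply: sumr_ge0 => m _; exact: sqr_ge0.
have M00 : 0 <= M0.
  rewrite mulr_ge0 // sumr_ge0 // => m _; rewrite mulr_ge0 // addr_ge0 // mulr_ge0 //.
have bnd W : coeff_dist f (sqpoly W) <= F -> forall i j, `|W i j| <= M.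
  move=> le i j.
  have pm (m : J2) : (sqpoly W)@_m <= 1 + 4 * F.
    have h1 : ((f - sqpoly W)@_m) ^+ 2 <= F.
      apply: le_trans le; rewrite /coeff_dist (bigD1 m) //= lerDl.
      by apply: sumr_ge0 => ? _; exact: sqr_ge0.
    have h2 : (f@_m) ^+ 2 <= F.
      rewrite /F /coeff_dist subr0 (bigD1 m) //= lerDl.
      by apply: sumr_ge0 => ? _; exact: sqr_ge0.
    move: h1 h2; rewrite mcoeffB; move: (f@_m) ((sqpoly W)@_m) => a b h1 h2.
    by have := sqr_ge0 (2 * a - b); have := sqr_ge0 (b - 1); nra.
  have tot : \sum_i \sum_j W i j ^+ 2 <= M0.
    apply: (@le_trans _ _ (2 * coeff_functional (2 * r).+1 tau (sqpoly W))).
      rewrite (raddf_sum (coeff_functional (2 * r).+1 tau)) mulr_sumr.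
      by apply: ler_sum => k _; exact: coer.
    rewrite ler_pM2l // /coeff_functional; apply: ler_sum => m _.
    by rewrite ler_wpM2l.
  have : W i j ^+ 2 <= M0.
    apply: le_trans tot; rewrite (bigD1 i) //= (bigD1 j) //= -addrA lerDl.
    rewrite addr_ge0 // sumr_ge0 // => ? _; rewrite ?sqr_ge0 //.
    by apply: sumr_ge0 => ? _; exact: sqr_ge0.
  rewrite -real_normK ?num_real // /M; move: `|W i j| (normr_ge0 (W i j)) => w w0; nra.
pose A : set 'rV[R]_#|{: 'I_n * J}| := [set v | forall i, `[- M, M]%classic (v 0 i)].
have cA : compact A.
  by apply: (@rV_compact _ _ (fun=> `[- M, M]%classic)) => i; exact: segment_compact.
have M1 : 0 <= M by rewrite addr_ge0.
have A0 : A 0 by move=> i /=; rewrite mxE in_itv /= oppr_le0 M1.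
have [|v vA vmin] := EVT_min_rV (ex_intro A 0 A0) cA (f := fun v => coeff_dist f (sqpoly (rowW v))).
  by apply: continuous_subspaceT; exact: coeff_dist_continuous.
exists (rowW v) => W'.
pose v' : 'rV[R]_#|{: 'I_n * J}| := \row_k W' (enum_val k).1 (enum_val k).2.
have rv' : rowW v' = W'.
  by apply/funext => i; apply/funext => j; rewrite /rowW mxE enum_rankK.
have [le|gt] := leP (coeff_dist f (sqpoly W')) F.
  have := vmin v'; rewrite rv'; apply; rewrite inE => k /=.
  by rewrite in_itv /= mxE -ler_norml; exact: bnd.
apply: le_trans (ltW gt); have := vmin 0; rewrite inE => /(_ A0) /le_trans; apply.
rewrite /F (_ : sqpoly (rowW 0) = 0) // /sqpoly big1 // => i _.
by rewrite big1 ?expr0n // => j _; rewrite /rowW mxE scale0r.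
Qed.

(** Let [p] be the closest sum of squares and [rho] = f - p. If [rho] is nonzero, minus the inner
    product with [rho] separates: minimality makes it nonnegative on squares and at most 0 at [p],
    while at [rho] it is negative. *)
Theorem sos_separation (f : P) : degle (2 * r) f ->
  (exists2 s : seq P, {in s, forall h, degle r h} & f = \sum_(h <- s) h ^+ 2) \/
  (exists2 l : {scalar P}, sos_functional r l & l f < 0).
Proof.
move=> df; have [W Wmin] := exists_closest_gram f.
have Gmin G : (forall j k, G j k = G k j) ->
    (forall c : J -> R, 0 <= \sum_j \sum_k c j * c k * G j k) ->
    coeff_dist f (sqpoly W) <= coeff_dist f (gram_poly G).
  move=> Gs Gp; have [W' GW'] := psd_kernel_factor Gs Gp.
  have -> : G = fun j k => \sum_l W' l j * W' l k.
    by apply/funext => j; apply/funext => k.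
  by rewrite gram_poly_factor; exact: Wmin.
pose p := sqpoly W; pose G j k := \sum_i W i j * W i k.
have pG : p = gram_poly G by rewrite /p /sqpoly -gram_poly_factor.
have Gs j k : G j k = G k j by apply: eq_bigr => i _; rewrite mulrC.
have Gp (c : J -> R) : 0 <= \sum_j \sum_k c j * c k * G j k.
  have -> : \sum_j \sum_k c j * c k * G j k = \sum_i (\sum_j c j * W i j) ^+ 2.
    under eq_bigr => j _ do (under eq_bigr => k _ do rewrite mulr_sumr; rewrite exchange_big /=).
    rewrite exchange_big; apply: eq_bigr => i _ /=.
    rewrite expr2 mulr_suml; apply: eq_bigr => j _.
    rewrite mulr_sumr; apply: eq_bigr => k _; ring.
  by apply: sumr_ge0 => i _; exact: sqr_ge0.
pose rho := f - p.
pose l : {scalar P} := coeff_functional (2 * r).+1 (fun m => - rho@_m).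
have distE g t : coeff_dist f (p + t *: g) - coeff_dist f p =
    t * (2 * l g) + t ^+ 2 * \sum_(m : J2) (g@_m) ^+ 2.
  have -> : l g = \sum_(m : J2) - rho@_m * g@_m by [].
  rewrite /coeff_dist -sumrB !mulr_sumr -big_split; apply: eq_bigr => m _ /=.
  rewrite opprD addrA -/rho mcoeffB mcoeffZ; ring.
(* First-order optimality at [G] along a direction [H] that stays in the positive cone. It is used
   for [H] of rank one, and for [H] = -G, which shrinks [p] towards 0. *)
have slope (H : J -> J -> R) : (forall j k, H j k = H k j) ->
   (forall t (c : J -> R), 0 < t <= 1 -> 0 <= \sum_j \sum_k c j * c k * (G j k + t * H j k)) ->
   0 <= l (gram_poly H).
  move=> Hs Hp; suff : 0 <= 2 * l (gram_poly H) by rewrite pmulr_rge0.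
  apply: (@quadratic_nonneg_slope _ (\sum_(m : J2) ((gram_poly H)@_m) ^+ 2)) => t t01.
  rewrite -distE subr_ge0 pG -gram_polyD -pG; apply: Gmin => [j k|c].
    by rewrite Gs Hs.
  exact: Hp.
have lsos : sos_functional r l.
  move=> h dh; rewrite (mpolywE dh) -gram_poly_sqr; apply: slope => [j k|t c /andP[t0 _]].
    exact: mulrC.
  have -> : \sum_j \sum_k c j * c k * (G j k + t * (h@_j * h@_k)) =
     \sum_j \sum_k c j * c k * G j k + t * (\sum_j c j * h@_j) ^+ 2.
    rewrite expr2 mulr_suml mulr_sumr -big_split; apply: eq_bigr => j _ /=.
    rewrite !mulr_sumr -big_split; apply: eq_bigr => k _ /=; ring.
  by rewrite addr_ge0 // mulr_ge0 ?sqr_ge0 // ltW.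
have lp : l p <= 0.
  rewrite -oppr_ge0 -raddfN /=.
  have -> : - p = gram_poly (fun j k => - G j k).
    by rewrite pG /gram_poly -sumrN; apply: eq_bigr => j _; rewrite -sumrN;
       apply: eq_bigr => k _; rewrite scaleNr.
  apply: slope => [j k|t c /andP[t0 t1]]; first by rewrite Gs.
  have -> : \sum_j \sum_k c j * c k * (G j k + t * - G j k) =
     (1 - t) * \sum_j \sum_k c j * c k * G j k.
    rewrite mulr_sumr; apply: eq_bigr => j _; rewrite mulr_sumr.
    by apply: eq_bigr => k _; ring.
  by rewrite mulr_ge0 // subr_ge0.
have dp : degle (2 * r) p.
  apply: degle_sum => i _; rewrite mulnC; apply: degleX.
  apply: degle_sum => j _; apply: degleZ; rewrite /degle msizeX; exact: bmdeg.
have lrho : l rho = - \sum_(m : J2) (rho@_m) ^+ 2.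
  by rewrite -sumrN; apply: eq_bigr => m _; rewrite mulNr expr2.
have [rho0|rho0] := eqVneq (\sum_(m : J2) (rho@_m) ^+ 2) 0.
  left; exists [seq \sum_j W i j *: 'X_[j] | i : 'I_n].
    move=> h /mapP[i _ ->]; apply: degle_sum => j _; apply: degleZ.
    by rewrite /degle msizeX; exact: bmdeg.
  have : rho = 0.
    have drho : degle (2 * r) rho := degleB df dp.
    rewrite (mpolywE drho) big1 // => m _.
    have /psumr_eq0P : \sum_(m : J2) (rho@_m) ^+ 2 = 0 by [].
    move=> /(_ (fun _ _ => sqr_ge0 _) m isT)/eqP; rewrite sqrf_eq0 => /eqP ->.
    by rewrite scale0r.
  move=> /eqP; rewrite subr_eq0 => /eqP ->.
  by rewrite /p /sqpoly big_image.
right; exists l => //.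
rewrite -(subrK p f) raddfD /= -/rho lrho.
have : 0 < \sum_(m : J2) (rho@_m) ^+ 2.
  by rewrite lt_def rho0 sumr_ge0 // => m _; exact: sqr_ge0.
lra.
Qed.
End Separation.

(** * The moment functional of a distribution *)

Section Moments.
Local Open Scope classical_set_scope.
Variables (R : realType) (d r : nat) (D : probability (d.-tuple R) R).
Local Notation P := {mpoly R[d]}.
Local Notation q := (2 * r)%N.
Hypothesis Dq : finite_moment D q.

Lemma norm2_ge0 (x : d.-tuple R) : 0 <= norm2 x.
Proof. exact: sqrtr_ge0. Qed.

Lemma dotp_sqE (x : d.-tuple R) : dotp x x = \sum_i tnth x i ^+ 2.
Proof. by apply: eq_bigr => i _; rewrite expr2. Qed.

Lemma norm2_exprE (x : d.-tuple R) : norm2 x ^+ q = dotp x x ^+ r.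
Proof.
rewrite exprM sqr_sqrtr // dotp_sqE; apply: sumr_ge0 => i _; exact: sqr_ge0.
Qed.

Lemma tnth_le_norm2 (x : d.-tuple R) i : `|tnth x i| <= norm2 x.
Proof.
rewrite -sqrtr_sqr ler_wsqrtr // dotp_sqE (bigD1 i) //= lerDl.
by apply: sumr_ge0 => j _; exact: sqr_ge0.
Qed.

Definition monom_fun (m : 'X_{1..d}) (x : d.-tuple R) : R :=
  \prod_i tnth x i ^+ m i.

(** Coordinates are bounded by the norm, and lower powers of the norm by 1 or by its [q]-th power;
    thus the [q]-th moment alone gives integrability of all these monomials. *)
Lemma monom_fun_le m x : (mdeg m <= q)%N -> `|monom_fun m x| <= 1 + norm2 x ^+ q.
Proof.
move=> mq; apply: (@le_trans _ _ (norm2 x ^+ mdeg m)).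
  rewrite normr_prod mdegE -prodrXr; apply: ler_prod => i _.
  by rewrite normr_ge0 normrX lerXn2r ?nnegrE ?norm2_ge0 ?tnth_le_norm2.
have [x1|/ltW x1] := leP (norm2 x) 1.
  apply: (@le_trans _ _ 1); first by rewrite exprn_ile1 ?norm2_ge0.
  by rewrite lerDl exprn_ge0 ?norm2_ge0.
by apply: (@le_trans _ _ (norm2 x ^+ q)); rewrite ?ler_weXn2l // lerDr.
Qed.

Lemma measurable_monom_fun m : measurable_fun setT (monom_fun m).
Proof.
apply: measurable_prod => i _; apply: measurable_funX.
exact: measurable_tnth.
Qed.

Lemma integrable_norm2 : D.-integrable setT (fun x => (1 + norm2 x ^+ q)%:E).
Proof.
have -> : (fun x : d.-tuple R => (1 + norm2 x ^+ q)%:E) =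
          ((fun x => (1%:E)) \+ (fun x => (norm2 x ^+ q)%:E))%E by [].
apply: integrableD => //; first exact: finite_measure_integrable_cst.
apply/integrableP; split.
  apply/measurable_EFinP; under eq_fun do rewrite norm2_exprE.
  apply: measurable_funX; apply: measurable_sum => i.
  by apply: measurable_funM; exact: measurable_tnth.
under eq_integral do rewrite gee0_abs ?lee_fin ?exprn_ge0 ?norm2_ge0 //.
by move: Dq; rewrite /finite_moment unlock.
Qed.

Lemma integrable_monom_fun m : (mdeg m <= q)%N ->
  D.-integrable setT (EFin \o monom_fun m).
Proof.
move=> mq; apply: (le_integrable _ _ _ integrable_norm2) => //.
  by apply/measurable_EFinP; exact: measurable_monom_fun.
move=> x _ /=; rewrite lee_fin [leRHS]ger0_norm ?monom_fun_le //.
by rewrite addr_ge0 // exprn_ge0 ?norm2_ge0.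
Qed.

Definition moment_functional : {scalar P} :=
  coeff_functional q.+1 (fun m => fine 'E_D[monom_fun m]).

Lemma meval_monomE (g : P) x : degle q g ->
  g.@[tnth x] = \sum_(m : 'X_{1..d < q.+1}) g@_m * monom_fun m x.
Proof.
move=> dg; rewrite {1}(mpolywE dg) raddf_sum; apply: eq_bigr => m _.
by rewrite /= mevalZ mevalX.
Qed.

Lemma expectation_meval (g : P) : degle q g ->
  ('E_D[fun x => g.@[tnth x]] = (moment_functional g)%:E)%E.
Proof.
move=> dg; rewrite unlock.
under eq_integral do rewrite meval_monomE // -sumEFin.
have mi (m : 'X_{1..d < q.+1}) : D.-integrable setT (EFin \o monom_fun m).
  by apply: integrable_monom_fun; rewrite -ltnS; exact: bmdeg.
have mi' (m : 'X_{1..d < q.+1}) : D.-integrable setT (fun x => (g@_m * monom_fun m x)%:E).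
  exact: (integrableZl measurableT (g@_m) (mi m)).
rewrite integral_sum // -sumEFin; apply: eq_bigr => m _.
under eq_integral do rewrite EFinM.
rewrite integralZl //; last exact: mi.
rewrite mulrC EFinM unlock fineK //; exact: (integrable_fin_num measurableT (mi m)).
Qed.

Lemma moment_functional_pos : positive_functional q moment_functional.
Proof.
move=> g dg g0; rewrite -lee_fin -expectation_meval // unlock.
by apply: integral_ge0 => x _; rewrite lee_fin.
Qed.

Lemma linform_tnth (v : d.-tuple R) (x : d.-tuple R) :
  (linform (tnth v)).@[tnth x] = dotp x v.
Proof. by rewrite linform_eval; apply: eq_bigr => i _; rewrite mulrC. Qed.

Lemma degle_linform_expr c n : degle n (linform c ^+ n : P).
Proof. by rewrite -[X in degle X _]mul1n; exact/degleX/degle_linform. Qed.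

Lemma expectation_dotp (v : d.-tuple R) :
  ('E_D[fun x => (dotp x v ^+ q)%R] = (moment_functional (linform (tnth v) ^+ q))%:E)%E.
Proof.
rewrite -expectation_meval; last exact: degle_linform_expr.
by congr expectation; apply/funext => x; rewrite rmorphXn /= linform_tnth.
Qed.

(** The coefficient of each v^m in <x, v>^q is a polynomial in [x] of degree at most [q], on which
    the functional is the expectation. *)
Lemma moment_polyE :
  moment_poly D q = map_mpoly moment_functional (pairing R d ^+ q).
Proof.
have pE : pairing R d ^+ q =
    \sum_(a : {ffun 'I_q -> 'I_d}) tens (\prod_k 'X_(a k)) (\prod_k 'X_(a k)).
  exact: expr_sum_tens.
have dX (a : {ffun 'I_q -> 'I_d}) : degle q (\prod_k 'X_(a k) : P).
  have es : (\sum_(k < q) 1)%N = q by rewrite sum1_card card_ord.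
  by rewrite -[X in degle X _]es; apply: degle_prod => k; exact: degleXU.
have dm : degle q (map_mpoly moment_functional (pairing R d ^+ q)).
  rewrite pE (raddf_sum (map_mpoly moment_functional)).
  by apply: degle_sum => a _ /=; rewrite map_tens; exact: degleZ.
rewrite [RHS](mpolywE dm); apply: eq_bigr => m _; congr (_ *: _).
rewrite mcoeff_map_mpoly.
have dc : degle q ((pairing R d ^+ q)@_m).
  rewrite pE raddf_sum; apply: degle_sum => a _ /=.
  rewrite mcoeffCM mcoeff_map_mpoly mulrC mul_mpolyC; exact: degleZ.
transitivity (fine ('E_D[fun x => ((pairing R d ^+ q)@_m).@[tnth x]])%E); last first.
  by rewrite expectation_meval.
congr (fine (expectation _ _)); apply/funext => x.
transitivity ((map_mpoly (meval (tnth x)) (pairing R d ^+ q))@_m); last first.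
  by rewrite mcoeff_map_mpoly.
rewrite rmorphXn /=; congr ((_ ^+ q)@_m).
rewrite (raddf_sum (map_mpoly (meval (tnth x)))); apply: eq_bigr => i _ /=.
rewrite rmorphM /= map_mpolyC /= mevalXU mul_mpolyC; congr (_ *: _).
by apply/mpolyP => k; rewrite !mcoeff_map_mpoly /= mevalC.
Qed.

Lemma bounded_moment_functional (B : R) : bounded_moment D B q ->
  forall c, moment_functional (linform c ^+ q) <= B ^+ q * (\sum_i c i ^+ 2) ^+ r.
Proof.
move=> bD c; have := bD [tuple c i | i < d]; rewrite expectation_dotp lee_fin.
rewrite norm2_exprE dotp_sqE.
have -> : linform (tnth [tuple c i | i < d]) = linform c :> P.
  by apply: eq_bigr => i _; rewrite tnth_mktuple.
by under eq_bigr do rewrite tnth_mktuple.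
Qed.

Lemma hypercontractive_functional (Sigma : 'M[R]_d) (B : R) :
  hypercontractive D Sigma B q -> forall c,
  moment_functional (linform c ^+ q) <=
    B ^+ q * (\sum_i \sum_j c i * Sigma i j * c j) ^+ r.
Proof.
move=> bD c; have := bD [tuple c i | i < d]; rewrite expectation_dotp lee_fin.
have -> : linform (tnth [tuple c i | i < d]) = linform c :> P.
  by apply: eq_bigr => i _; rewrite tnth_mktuple.
have -> : (q./2 = r)%N by rewrite mul2n doubleK.
congr (_ <= _ * _ ^+ _).
by apply: eq_bigr => i _; apply: eq_bigr => j _; rewrite !tnth_mktuple.
Qed.

Lemma covariance_functional (Sigma : 'M[R]_d) : (0 < r)%N ->
  mean_zero D -> has_covariance D Sigma ->
  forall i j, Sigma i j = moment_functional ('X_i * 'X_j).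
Proof.
move=> r0 mD cD i j.
have dX : degle q ('X_i * 'X_j : P).
  apply: (@degleW _ _ 2); first by rewrite -[2%N]muln1 leq_mul2l.
  exact: (degleM (degleXU _ _) (degleXU _ _)).
apply: EFin_inj; rewrite -cD -expectation_meval // unlock.
have [_ ->] := mD i; have [_ ->] := mD j.
congr expectation; apply/funext => x /=.
by rewrite !fctE /= !subr0 mevalM !mevalXU.
Qed.
End Moments.

(** * From bounds on functionals to certificates; the quadratic case *)

Section Certificates.
Variables (R : realType) (d s : nat).
Local Notation P := {mpoly R[d]}.
Local Notation q := (2 * s.+1)%N.

Lemma sos_of_dual (f : P) n : degle (2 * n) f ->
  (forall l : {scalar P}, sos_functional n l -> 0 <= l f) -> is_sos (2 * n) f.
Proof.
move=> df fl; have [[hs dhs ->]|[l lsos lf]] := sos_separation df; last first.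
  by have := fl l lsos; rewrite leNgt lf.
exists hs => // h /dhs dh; rewrite -/(degle (2 * n) (h ^+ 2)) mulnC; exact: degleX.
Qed.

Lemma sos_functional_sqnorm_ge0 (l : {scalar P}) :
  sos_functional s.+1 l -> 0 <= l (sqnorm R d ^+ s.+1).
Proof.
move=> lsos; rewrite exprS {1}/sqnorm mulr_suml (raddf_sum l).
by apply: sumr_ge0 => i _; exact: dual_marginal_ge0.
Qed.

Lemma pairing_le (L l : {scalar P}) (K c : R) : (0 < d)%N -> 0 <= K -> 0 <= c ->
  c ^+ 2 = K ^+ 2 * d%:R ^+ s ->
  positive_functional q L -> moment_bound s K L -> sos_functional s.+1 l ->
  tensor_eval L l (pairing R d ^+ q) <= c * l (sqnorm R d ^+ s.+1).
Proof.
move=> d0 K0 c0 cE Lpos Lbd lsos.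
have N0 := sos_functional_sqnorm_ge0 lsos.
have := pairing_bound d0 K0 Lpos Lbd lsos; rewrite -cE -exprMn.
rewrite -ler_sqrt ?sqr_ge0 // !sqrtr_sqr [leRHS]ger0_norm ?mulr_ge0 //.
exact/le_trans/ler_norm.
Qed.

(** By the binomial formula the left side is a polynomial in [e], and for [e] at most 1 every
    positive power of [e] is at most [e]. *)
Lemma functional_perturbation_le (l : {scalar P}) (a b : P) n :
  exists Y, forall e, 0 < e <= 1 -> l ((a + e *: b) ^+ n) <= l (a ^+ n) + e * Y.
Proof.
pose ci i := l (a ^+ (n - i) * b ^+ i *+ 'C(n, i)).
exists (\sum_(i < n) `|ci i.+1|) => e /andP[e0 e1].
have -> : l ((a + e *: b) ^+ n) = \sum_(i < n.+1) e ^+ i * ci i.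
  rewrite exprDn (raddf_sum l); apply: eq_bigr => i _.
  by rewrite exprZn -scalerAr scalerMnr [LHS]scalarZ.
rewrite big_ord_recl /= expr0 mul1r {1}/ci subn0 mulr1 bin0 mulr1n lerD2l.
rewrite mulr_sumr; apply: ler_sum => i _; rewrite /bump /= add1n.
apply: (@le_trans _ _ (e ^+ i.+1 * `|ci i.+1|)).
  by rewrite ler_wpM2l ?ler_norm // exprn_ge0 // ltW.
by rewrite ler_wpM2r // exprS ler_piMr ?(ltW e0) // exprn_ile1 ?(ltW e0).
Qed.

(** Factor S = Sigma + e I as W^T W. Replacing [v] by W v turns |v|^2 into the form of [S];
    replacing [x] by its image under the inverse transpose of [W] preserves the pairing and gives
    the Euclidean moment bound. *)
Lemma pairing_le_quadratic (L l : {scalar P}) (K c : R) (Sigma : 'M[R]_d) :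
  (0 < d)%N -> 0 <= K -> 0 <= c -> c ^+ 2 = K ^+ 2 * d%:R ^+ s ->
  Sigma^T = Sigma -> psdmx Sigma -> positive_functional q L ->
  (forall v, L (linform v ^+ q) <= K * (\sum_i \sum_j v i * Sigma i j * v j) ^+ s.+1) ->
  sos_functional s.+1 l ->
  tensor_eval L l (pairing R d ^+ q) <=
    c * l ((\sum_i \sum_j Sigma i j *: ('X_i * 'X_j)) ^+ s.+1).
Proof.
move=> d0 K0 c0 cE Ss Sp Lpos Lbd lsos.
set V := tensor_eval _ _ _; set a := \sum_i _.
have [Y lY] := functional_perturbation_le l a (sqnorm R d) s.+1.
apply/ler_addgt0Pr => z z0.
(* Makes the perturbation error [c * (e * Y)] at most [z]; the added 1 keeps the denominator
   positive. *)
pose e := Num.min 1 (z / (c * `|Y| + 1)).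
have cY : 0 <= c * `|Y| by rewrite mulr_ge0.
have cY1 : 0 < c * `|Y| + 1 by rewrite ltr_wpDl.
have e0 : 0 < e by rewrite lt_min ltr01 divr_gt0.
have e1 : e <= 1 by rewrite ge_min lexx.
have ez : c * (e * Y) <= z.
  have : e <= z / (c * `|Y| + 1) by rewrite ge_min lexx orbT.
  rewrite ler_pdivlMr // mulrDr mulr1 => h.
  have : e * Y <= e * `|Y| by rewrite ler_pM2l // ler_norm.
  move=> /(ler_wpM2l c0); nra.
pose S := Sigma + e%:M.
have SE (u : 'rV[R]_d) : (u *m S *m u^T) 0 0 = (u *m Sigma *m u^T) 0 0 + e * \sum_i u 0 i ^+ 2.
  rewrite mulmxDr mulmxDl mul_mx_scalar -scalemxAl [LHS]mxE; congr (_ + _).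
  by rewrite !mxE; congr (_ * _); apply: eq_bigr => i _; rewrite mxE expr2.
have [||W SW] := @psdmx_factor _ _ S.
- by rewrite linearD /= Ss tr_scalar_mx.
- move=> u; rewrite SE addr_ge0 // mulr_ge0 ?(ltW e0) // sumr_ge0 // => i _.
  exact: sqr_ge0.
(* If u W^T = 0 then u S u^T = 0, which is at least e |u|^2. *)
have Wu : W \in unitmx.
  rewrite -unitmx_tr -row_free_unit -kermx_eq0; apply/eqP/row_matrixP => i; rewrite row0.
  have : row i (kermx W^T) *m W^T = 0 by rewrite -row_mul mulmx_ker row0.
  move: (row i _) => u uW; have := SE u; rewrite SW mulmxA uW !mul0mx mxE => h.
  have /psumr_eq0P u0 : \sum_i u 0 i ^+ 2 = 0.
    have : 0 <= \sum_i u 0 i ^+ 2 by apply: sumr_ge0 => j _; exact: sqr_ge0.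
    have := Sp u; move: h e0; nra.
  apply/rowP => j; rewrite [RHS]mxE; apply/eqP; rewrite -sqrf_eq0 u0 // => k _.
  exact: sqr_ge0.
pose A := (invmx W)^T.
have AW : A^T *m W = 1%:M by rewrite trmxK mulVmx.
rewrite /V -(tensor_eval_comp L l q AW).
apply: (@le_trans _ _ (c * (l \o comp_mpoly (linforms W)) (sqnorm R d ^+ s.+1))).
  apply: (pairing_le d0 K0 c0 cE).
  - exact: comp_positive_functional.
  - move=> v /=; rewrite rmorphXn /= comp_linform; apply: le_trans (Lbd _) _.
    apply: ler_wpM2l => //.
    (* Then u Sigma u^T <= u S u^T = |v|^2, as [A] inverts W^T. *)
    pose u : 'rV[R]_d := (\row_i v i) *m A.
    have uE j : \sum_i v i * A i j = u 0 j.
      by rewrite [RHS]mxE; apply: eq_bigr => i _; congr (_ * _); rewrite mxE.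
    have -> : \sum_i \sum_j (\sum_k v k * A k i) * Sigma i j * (\sum_k v k * A k j) =
        (u *m Sigma *m u^T) 0 0.
      rewrite mxE exchange_big; apply: eq_bigr => j _ /=.
      rewrite [u^T _ _]mxE [(u *m Sigma) _ _]mxE mulr_suml; apply: eq_bigr => i _.
      by rewrite !uE.
    have -> : \sum_i v i ^+ 2 = (u *m S *m u^T) 0 0.
      have -> : u *m S *m u^T = (\row_i v i) *m (\row_i v i)^T.
        have AWt : A *m W^T = 1%:M by rewrite -trmx_mul mulmxV ?trmx1.
        have WAt : W *m A^T = 1%:M by rewrite trmxK mulmxV.
        rewrite SW /u trmx_mul !mulmxA -(mulmxA _ A) AWt mulmx1.
        by rewrite -(mulmxA _ W) WAt mulmx1.
      by rewrite mxE; apply: eq_bigr => i _; rewrite !mxE expr2.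
    have p1 := Sp u.
    have p2 : 0 <= e * \sum_i u 0 i ^+ 2.
      by rewrite mulr_ge0 ?(ltW e0) // sumr_ge0 // => i _; exact: sqr_ge0.
    by rewrite lerXn2r ?nnegrE ?SE ?addr_ge0 // lerDl.
  - exact: comp_sos_functional.
rewrite /= rmorphXn /= comp_sqnorm -SW.
have -> : \sum_i \sum_j S i j *: ('X_i * 'X_j) = a + e *: sqnorm R d.
  rewrite scaler_sumr -big_split; apply: eq_bigr => i _ /=.
  under eq_bigr do rewrite mxE scalerDl.
  rewrite big_split /=; congr (_ + _).
  rewrite (bigD1 i) //= mxE eqxx mulr1n expr2 big1 ?addr0 // => j ji.
  by rewrite mxE eq_sym (negPf ji) mulr0n scale0r.
have := ler_wpM2l c0 (lY e _); rewrite e0 e1 => /(_ isT) /le_trans; apply.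
by rewrite mulrDr lerD2l.
Qed.
End Certificates.

(** With q = 2(s + 1), the exponent is (1/4 - 1/(2q)) 2q = q/2 - 1 = s; squaring avoids half-integer
    powers of [d]. *)
Lemma powR_certificate_constant (R : realType) (d s : nat) (B : R) : (0 < d)%N ->
  ((powR d%:R (4^-1 - (2 * (2 * s.+1)%:R)^-1) * B) ^+ (2 * s.+1)) ^+ 2 =
  (B ^+ (2 * s.+1)) ^+ 2 * d%:R ^+ s.
Proof.
move=> d0; rewrite !exprMn mulrC; congr (_ * _).
rewrite -!powR_mulrn ?powR_ge0 // -!powRrM; congr powR.
rewrite natrM -(natr1 s); field.
by rewrite natr1 pnatr_eq0.
Qed.

Theorem theorem3p3 :
  exists C : nat,
    forall (R : realType) (q d : nat) (D : probability (d.-tuple R) R)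
           (Sigma : 'M[R]_d) (B : R),
      (0 < q)%N -> ~~ odd q ->
      mean_zero D -> has_covariance D Sigma -> finite_moment D q ->
      0 < B ->
      (bounded_moment D B q ->
         certifiably_bounded D
           (powR d%:R (4^-1 - (2 * q%:R)^-1) * B) q (C * q)%N)
      /\
      (hypercontractive D Sigma B q ->
         certifiably_hypercontractive D Sigma
           (powR d%:R (4^-1 - (2 * q%:R)^-1) * B) q (C * q)%N).
Proof.
exists 1%N => R q d D Sigma B q0 qe mD cD Dq B0; rewrite mul1n.
have [s qE] : exists s, q = (2 * s.+1)%N.
  exists q./2.-1; rewrite mul2n prednK ?even_halfK // half_gt0.
  by case: q q0 qe {Dq} => [|[]].
rewrite {q q0 qe}qE in Dq *.
have hq : ((2 * s.+1)./2 = s.+1)%N by rewrite mul2n doubleK.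
rewrite /certifiably_bounded /certifiably_hypercontractive hq.
set c := (powR _ _ * B) ^+ _.
have K0 : 0 <= B ^+ (2 * s.+1) by rewrite exprn_ge0 // ltW.
have c0 : 0 <= c by rewrite exprn_ge0 // mulr_ge0 ?powR_ge0 // ltW.
have dm : degle (2 * s.+1) (moment_poly D (2 * s.+1)).
  apply: degle_sum => m _; apply: degleZ; rewrite /degle msizeX; exact: bmdeg.
have dq (p : {mpoly R[d]}) : degle 2 p -> degle (2 * s.+1) (p ^+ s.+1) by exact: degleX.
have dquad : degle 2 (quadf_poly Sigma).
  apply: degle_sum => i _; apply: degle_sum => j _; apply/degleZ.
  exact: (degleM (degleXU _ _) (degleXU _ _)).
have Lpos := moment_functional_pos Dq.
have momE (l : {scalar {mpoly R[d]}}) : l (moment_poly D (2 * s.+1)) =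
    tensor_eval (moment_functional (s.+1) D) l (pairing R d ^+ (2 * s.+1)).
  by rewrite moment_polyE.
(* Without variables the forms and their positive powers are 0, and the empty sum of squares is a
   certificate. *)
have [d0|d0] := posnP d.
  have noI (i : 'I_d) : False by case: i => i; rewrite d0.
  have m0 : moment_poly D (2 * s.+1) = 0.
    rewrite moment_polyE // /pairing big1 => [|i]; last by have := noI i.
    by rewrite expr0n /= raddf0.
  have sos0 (a : {mpoly R[d]}) : a = 0 -> is_sos (2 * s.+1) (c *: a ^+ s.+1 - moment_poly D (2 * s.+1)).
    by move=> ->; exists [::] => //; rewrite big_nil m0 expr0n /= scaler0 subr0.
  by split=> _; apply: sos0; apply: big1 => i; have := noI i.
have cE := powR_certificate_constant s B d0.
split=> [bD|hD].
- apply: sos_of_dual => [|l lsos].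
    apply: degleB dm; apply/degleZ/dq; exact: degle_sqnorm.
  rewrite raddfB /= scalarZ momE subr_ge0.
  apply: (pairing_le d0 K0 c0 cE Lpos _ lsos).
  exact: bounded_moment_functional.
apply: sos_of_dual => [|l lsos].
  by apply: degleB dm; apply/degleZ/dq.
rewrite raddfB /= scalarZ momE subr_ge0.
have SE := covariance_functional Dq (ltn0Sn s) mD cD.
apply: (pairing_le_quadratic d0 K0 c0 cE _ _ Lpos _ lsos).
- by apply/matrixP => i j; rewrite mxE !SE mulrC.
(* The form of the covariance is the second moment of <x, u>, hence nonnegative. *)
- move=> u; have -> : (u *m Sigma *m u^T) 0 0 = moment_functional (s.+1) D (linform (u 0) ^+ 2).
    rewrite expr2 linform_mul (raddf_sum (moment_functional s.+1 D)) mxE.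
    under eq_bigr do rewrite mxE mulr_suml.
    rewrite exchange_big; apply: eq_bigr => i _ /=.
    rewrite (raddf_sum (moment_functional s.+1 D)); apply: eq_bigr => j _ /=.
    by rewrite [RHS]scalarZ -SE [u^T _ _]mxE mulrAC.
  apply: Lpos => [|x]; last by rewrite rmorphXn sqr_ge0.
  apply: (@degleW _ _ 2); first by rewrite -[2%N]muln1 leq_mul2l.
  exact: degle_linform_expr.
exact: hypercontractive_functional.
Qed.
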